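(* Let $k$ be a field, $q\in k$, and let $\Lambda_q=kQ/I_q$ be the quiver algebra and $\mathbb{K}\to\Lambda_q$ the resolution described in the context. When regarded as $k$-linear chain maps (extended from the generators by the Leibniz rule below), the homotopy lifting maps $\psi_{\eta}$ (for any $q$) and $\psi_\chi$ (for $q=1$) associated with the $1$-cocycles $\eta=(a\ \ 0\ \ 0)$ and $\chi=(ab\ \ 0\ \ 0)$, namely, for $n\ge1$, $$\psi_{\eta_n}(\varepsilon^n_r) = \begin{cases} (n-r)\varepsilon^n_r & r=0,1,\ldots,n, \\ (n-1)\varepsilon^n_r & r=n+1,\end{cases}$$ $$\psi_{\chi_n}(\varepsilon^n_r) = \begin{cases} \big(\tfrac{1+(-1)^r}{2}\big)(-1)^{n+1}a\varepsilon^n_{r+1} + (n-r)\varepsilon^n_r b & r=0,1,\ldots,n-1, \\ 0 & r=n,\\ (n-1)( b\varepsilon^n_{r}+\varepsilon^n_1c ) & r=n+1, \end{cases}$$ and $\psi_{\eta_0}=\psi_{\chi_0}=0$ on generators, are derivation operators for $\eta$ and $\chi$ respectively.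
   Context: $Q$ is the quiver with two vertices $1,2$ (idempotents $e_1,e_2$), two loops $a,b$ at vertex $1$, and one arrow $c:1\to2$; paths are concatenated left to right. $I_q=\langle a^2,b^2,ab-qba,ac\rangle\subseteq kQ$ and $\Lambda_q=kQ/I_q$, $\Lambda_q^e=\Lambda_q\otimes_k\Lambda_q^{op}$. Set $f^0_0=e_1$, $f^0_1=e_2$; $f^1_0=a$, $f^1_1=b$, $f^1_2=c$; $f^2_0=a^2$, $f^2_1=ab-qba$, $f^2_2=b^2$, $f^2_3=ac$; and for $n>2$: $f^n_0=a^n$, $f^n_s=f^{n-1}_{s-1}b+(-q)^sf^{n-1}_sa$ $(0<s<n)$, $f^n_n=b^n$, $f^n_{n+1}=a^{n-1}c$. The projective bimodule resolution $\mathbb{K}$ of $\Lambda_q$ has $\mathbb{K}_n=\bigoplus_{r=0}^{n+1}\Lambda_q\,o(f^n_r)\otimes_k t(f^n_r)\Lambda_q$ with generators $\varepsilon^n_r=o(f^n_r)\otimes_k t(f^n_r)$ in the $r$-th summand ($o,t$ = origin and terminal vertex idempotents), augmentation $\mathbb{K}_0\to\Lambda_q$ given by multiplication, and differentials $d_1(\varepsilon^1_2)=c\varepsilon^0_1-\varepsilon^0_0c$, $$d_n(\varepsilon^n_r)=(1-\partial_{n,r})[a\varepsilon^{n-1}_r+(-1)^{n-r}q^r\varepsilon^{n-1}_ra]+(1-\partial_{r,0})[(-q)^{n-r}b\varepsilon^{n-1}_{r-1}+(-1)^n\varepsilon^{n-1}_{r-1}b]\quad (r\le n),$$ $$d_n(\varepsilon^n_{n+1})=a\varepsilon^{n-1}_n+(-1)^n\varepsilon^{n-1}_0c\quad(n\ge2),$$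 where $\partial_{r,s}=1$ if $r=s$ and $0$ otherwise. The notation $\eta=(\lambda_0\ \lambda_1\ \lambda_2)$ means the map $\mathbb{K}_1\to\Lambda_q$ with $\varepsilon^1_r\mapsto\lambda_r$. As derivations $\Lambda_q\to\Lambda_q$ (vanishing on $e_1,e_2$), $\eta(a)=a$, $\eta(b)=\eta(c)=0$, and (for $q=1$) $\chi(a)=ab$, $\chi(b)=\chi(c)=0$. For a derivation $\gamma:\Lambda_q\to\Lambda_q$, a derivation operator is a $k$-linear chain map $\tilde\gamma_\bullet:\mathbb{K}_\bullet\to\mathbb{K}_\bullet$ (i.e. $\tilde\gamma_{n-1}d_n=d_n\tilde\gamma_n$) lifting $\gamma$ such that for each $n$, $\tilde\gamma_n(x\varepsilon^n_ry)=\gamma(x)\varepsilon^n_ry+x\tilde\gamma_n(\varepsilon^n_r)y+x\varepsilon^n_r\gamma(y)$ for all $x,y\in\Lambda_q$ and all generators $\varepsilon^n_r$. ''Regarded as $k$-linear chain maps'' means taking $\tilde\gamma_n(\varepsilon^n_r):=\psi_{\gamma_n}(\varepsilon^n_r)$ and extending by this rule. *)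

(* Defs.v *)
From HB Require Import structures.
From mathcomp Require Import all_boot all_algebra generic_quotient ring_quotient.
From mathcomp Require Import finmap.
From mathcomp.multinomials Require Import monalg.
From mathcomp Require Import boolp.

Set Implicit Arguments.
Unset Strict Implicit.
Unset Printing Implicit Defensive.

Import GRing.Theory.
Local Open Scope ring_scope.
Local Open Scope quotient_scope.

Section FreeModule.
Variables (k : fieldType) (X : choiceType) (M : lmodType k).

(* The linear extension to the free module on X of a map X -> M. Locked, as are
   several constants below, to keep unification from unfolding finite maps. *)
Fact lin_ext_key : unit. Proof. by []. Qed.
Definition lin_ext : (X -> M) -> {malg k[X]} -> M :=
  locked_with lin_ext_key (fun f g => \sum_(x <- msupp g) g@_x *: f x).
Canonical lin_ext_unlockable := [unlockable fun lin_ext].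

Lemma lin_extE f g : lin_ext f g = \sum_(x <- msupp g) g@_x *: f x.
Proof. by rewrite unlock. Qed.

Lemma lin_extw f g (d : {fset X}) :
  fsubset (msupp g) d -> lin_ext f g = \sum_(x <- d) g@_x *: f x.
Proof.
move=> le_gd; rewrite lin_extE (big_fset_incl _ le_gd) //= => x _ /mcoeff_outdom ->.
by rewrite scale0r.
Qed.

Lemma lin_ext_linear f : linear (lin_ext f).
Proof.
move=> c g h.
pose d := fsetU (msupp g) (fsetU (msupp h) (msupp (c *: g + h))).
rewrite !(@lin_extw _ _ d) ?scaler_sumr -?big_split /d.
- by apply: eq_bigr => x _; rewrite mcoeffD mcoeffZ scalerDl scalerA.
- by rewrite fsetUCA fsubsetUl.
- by rewrite fsubsetUl.
- by rewrite fsetUA fsubsetUr.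
Qed.

HB.instance Definition _ f :=
  GRing.isLinear.Build k {malg k[X]} M _ (lin_ext f) (lin_ext_linear f).

Lemma lin_extU f x : lin_ext f << x >> = f x.
Proof. by rewrite lin_extE msuppU oner_eq0 big_seq_fset1 mcoeffUU scale1r. Qed.

End FreeModule.

Section SpanAndQuotient.
Variables (k : fieldType) (V : lmodType k).

Definition in_lspan (R : V -> Prop) (v : V) : Prop :=
  exists2 t : seq (k * V), (forall z, z \in t -> R z.2) &
    v = \sum_(z <- t) z.1 *: z.2.

Definition lspan (R : V -> Prop) : pred V := fun v => `[< in_lspan R v >].

Lemma span_gen R v : R v -> v \in lspan R.
Proof.
move=> Rv; apply/asboolP; exists [:: (1, v)].
  by move=> z; rewrite inE => /eqP ->.
by rewrite big_seq1 scale1r.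
Qed.

Lemma span_submod R : submod_closed (lspan R).
Proof.
split=> [|c u v /asboolP[s Hs ->] /asboolP[t Ht ->]].
  by apply/asboolP; exists [::] => //; rewrite big_nil.
apply/asboolP; exists ([seq (c * z.1, z.2) | z <- s] ++ t).
  by move=> z; rewrite mem_cat => /orP[/mapP[y /Hs Ry ->]|/Ht].
rewrite big_cat big_map scaler_sumr /=; congr (_ + _).
by apply: eq_bigr => z _; rewrite scalerA.
Qed.

HB.instance Definition _ R :=
  GRing.isSubmodClosed.Build k V (lspan R) (span_submod R).

Definition lquot (R : V -> Prop) := Quotient.quot (GRing.ZmodClosed.clone V (lspan R) _).

HB.instance Definition _ R := GRing.Zmodule.on (lquot R).
Variable R : V -> Prop.

Fact lpi_key : unit. Proof. by []. Qed.
Definition lpi : V -> lquot R := locked_with lpi_key (fun v => \pi_(lquot R) v).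
Canonical lpi_unlockable := [unlockable fun lpi].
Definition lrepr (x : lquot R) : V := repr (x : Quotient.quot _).

Lemma lreprK : cancel lrepr lpi.
Proof. by move=> x; rewrite unlock reprK. Qed.

Lemma lpi_eq u v : u - v \in lspan R -> lpi u = lpi v.
Proof. by rewrite unlock Quotient.idealrBE => /eqP. Qed.

Lemma lpi_inj u v : lpi u = lpi v -> u - v \in lspan R.
Proof. by rewrite unlock Quotient.idealrBE => e; apply/eqP. Qed.

Lemma lpiD u v : lpi (u + v) = lpi u + lpi v.
Proof. by rewrite unlock Quotient.pi_add. Qed.

Definition lquot_scale (c : k) (x : lquot R) : lquot R := lpi (c *: lrepr x).

Lemma lquot_scaleE c v : lquot_scale c (lpi v) = lpi (c *: v).
Proof.
by apply: lpi_eq; rewrite -scalerBr rpredZ //; apply: lpi_inj; rewrite lreprK.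
Qed.

Fact lquot_scaleA c d x : lquot_scale c (lquot_scale d x) = lquot_scale (c * d) x.
Proof. by rewrite -[x]lreprK !lquot_scaleE scalerA. Qed.
Fact lquot_scale1 : left_id 1 lquot_scale.
Proof. by move=> x; rewrite -[x]lreprK lquot_scaleE scale1r. Qed.
Fact lquot_scaleDr : right_distributive lquot_scale +%R.
Proof.
by move=> c x y; rewrite -[x]lreprK -[y]lreprK -lpiD !lquot_scaleE scalerDr lpiD.
Qed.
Fact lquot_scaleDl x : {morph lquot_scale^~ x : c d / c + d}.
Proof. by move=> c d; rewrite -[x]lreprK !lquot_scaleE scalerDl lpiD. Qed.

HB.instance Definition _ := GRing.Zmodule_isLmodule.Build k (lquot R)
  lquot_scaleA lquot_scale1 lquot_scaleDr lquot_scaleDl.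

Lemma lpi_linear : linear lpi.
Proof. by move=> c u v; rewrite lpiD -lquot_scaleE. Qed.

HB.instance Definition _ := GRing.isLinear.Build k V (lquot R) _ lpi lpi_linear.

End SpanAndQuotient.

Section Tensor.
Variables (k : fieldType) (U V : lmodType k).

Notation free := {malg k[(U * V)%type]}.

Inductive tens_rel : free -> Prop :=
| tens_relDl u u' v : tens_rel (<<(u + u', v)>> - <<(u, v)>> - <<(u', v)>>)
| tens_relDr u v v' : tens_rel (<<(u, v + v')>> - <<(u, v)>> - <<(u, v')>>)
| tens_relZl c u v : tens_rel (<<(c *: u, v)>> - c *: <<(u, v)>>)
| tens_relZr c u v : tens_rel (<<(u, c *: v)>> - c *: <<(u, v)>>).

Definition tensor := lquot tens_rel.
HB.instance Definition _ := GRing.Lmodule.on tensor.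

Fact tens_key : unit. Proof. by []. Qed.
Definition tens : U -> V -> tensor :=
  locked_with tens_key (fun u v => lpi tens_rel <<(u, v)>>).
Canonical tens_unlockable := [unlockable fun tens].

Definition bilin (M : lmodType k) (f : U -> V -> M) : Prop :=
  (forall v, linear (f^~ v)) /\ (forall u, linear (f u)).

(* The linear map sending tens u v to f u v; meaningful only for bilinear f. *)
Fact tens_lift_key : unit. Proof. by []. Qed.
Definition tens_lift (M : lmodType k) : (U -> V -> M) -> tensor -> M :=
  locked_with tens_lift_key
    (fun f z => lin_ext (fun p => f p.1 p.2) (lrepr z)).
Canonical tens_lift_unlockable M := [unlockable fun (@tens_lift M)].

Lemma tens_bilin : bilin tens.
Proof.
split=> [v c u u'|u c v v']; rewrite [tens]unlock -linearP.
- apply: lpi_eq; rewrite opprD addrA.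
  have /span_gen e1 := tens_relDl (c *: u) u' v.
  have /span_gen e2 := tens_relZl c u v.
  by have := rpredD e1 e2; rewrite [X in X + _]addrAC addrA subrK addrAC.
- apply: lpi_eq; rewrite opprD addrA.
  have /span_gen e1 := tens_relDr u (c *: v) v'.
  have /span_gen e2 := tens_relZr c u v.
  by have := rpredD e1 e2; rewrite [X in X + _]addrAC addrA subrK addrAC.
Qed.

Section Lift.
Variables (M : lmodType k) (f : U -> V -> M).
Hypothesis f_bilin : bilin f.

Let F := lin_ext (fun p : U * V => f p.1 p.2).

Lemma bilin_span z : z \in lspan tens_rel -> F z = 0.
Proof.
have [fl fr] := f_bilin.
have fDl v u u' : f (u + u') v = f u v + f u' v.
  by have := fl v 1 u u'; rewrite !scale1r.
have fDr u v v' : f u (v + v') = f u v + f u v'.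
  by have := fr u 1 v v'; rewrite !scale1r.
have f0l v : f 0 v = 0 by apply: (addrI (f 0 v)); rewrite -fDl !addr0.
have f0r u : f u 0 = 0 by apply: (addrI (f u 0)); rewrite -fDr !addr0.
have fZl v c u : f (c *: u) v = c *: f u v.
  by have := fl v c u 0; rewrite !addr0 f0l addr0.
have fZr u c v : f u (c *: v) = c *: f u v.
  by have := fr u c v 0; rewrite !addr0 f0r addr0.
have FB g h : F (g - h) = F g - F h by exact: raddfB.
have FZ c g : F (c *: g) = c *: F g by exact: linearZ.
have FU p : F << p >> = f p.1 p.2 by exact: lin_extU.
have F0 y : tens_rel y -> F y = 0.
  case=> [u u' v|u v v'|c u v|c u v]; rewrite !(FB, FZ, FU) /=.
  - by rewrite fDl -addrA -opprD subrr.
  - by rewrite fDr -addrA -opprD subrr.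
  - by rewrite fZl subrr.
  - by rewrite fZr subrr.
move=> /asboolP[t Ht ->]; rewrite /F raddf_sum big_seq big1 // => x /Ht Hx.
by rewrite -[LHS]/(F (x.1 *: x.2)) FZ F0 // scaler0.
Qed.

Lemma tens_lift_pi z : tens_lift f (lpi tens_rel z) = F z.
Proof.
apply/eqP; rewrite unlock -subr_eq0 -[lin_ext _ _]/(F _) -linearB /=.
by apply/eqP/bilin_span/lpi_inj; rewrite lreprK.
Qed.

Lemma tens_liftE u v : tens_lift f (tens u v) = f u v.
Proof. by rewrite [tens]unlock tens_lift_pi /F lin_extU. Qed.

Lemma tens_lift_linear : linear (tens_lift f).
Proof.
move=> c x y; rewrite -[x]lreprK -[y]lreprK -linearP.
by rewrite !tens_lift_pi /F linearP.
Qed.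

End Lift.

Lemma tens_ext (M : lmodType k) (g h : tensor -> M) :
  linear g -> linear h -> (forall u v, g (tens u v) = h (tens u v)) -> g =1 h.
Proof.
move=> lg lh gh z.
have lZ (f : tensor -> M) : linear f -> scalable f by apply: scalable_linear.
have l0 (f : tensor -> M) : linear f -> f 0 = 0.
  by move=> lf; rewrite -[X in f X](scale0r (0 : tensor)) (lZ f lf) scale0r.
have lD (f : tensor -> M) : linear f -> {morph f : x y / x + y}.
  by move=> lf; have [] := GRing.semilinear_linear lf.
rewrite -[z]lreprK [lrepr z]monalgE [lpi _ _]linear_sum /=.
elim/big_ind: _ => [|x y gx gy|p _]; first by rewrite !l0.
  by rewrite !lD // gx gy.
have -> : << (lrepr z)@_p *g p >> = (lrepr z)@_p *: << p >> :> free.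
  by apply/malgP => q; rewrite mcoeffZ !mcoeffU mulrnAr mulr1.
rewrite [lpi _ _]linearZ /= !lZ //; case: p => u v; congr (_ *: _);
by have := gh u v; rewrite [tens]unlock.
Qed.

End Tensor.


Inductive vertex := V1 | V2.
Inductive arrow := Aa | Ab | Ac.

Definition vertex_code v := if v is V1 then true else false.
Definition vertex_decode b := if b then V1 else V2.
Fact vertex_codeK : cancel vertex_code vertex_decode. Proof. by case. Qed.
HB.instance Definition _ := Finite.copy vertex (can_type vertex_codeK).

Definition arrow_code x : option bool :=
  match x with Aa => None | Ab => Some true | Ac => Some false end.
Definition arrow_decode o :=
  match o with None => Aa | Some true => Ab | Some false => Ac end.
Fact arrow_codeK : cancel arrow_code arrow_decode. Proof. by case. Qed.
HB.instance Definition _ := Finite.copy arrow (can_type arrow_codeK).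

Definition src (x : arrow) : vertex := V1.
Definition tgt (x : arrow) : vertex := if x is Ac then V2 else V1.

(* A path is its origin together with its list of arrows, read left to right;
   the paths without arrows are the idempotents. *)
Fixpoint is_path (v : vertex) (s : seq arrow) : bool :=
  if s is x :: s' then (src x == v) && is_path (tgt x) s' else true.

Fixpoint endpoint (v : vertex) (s : seq arrow) : vertex :=
  if s is x :: s' then endpoint (tgt x) s' else v.

Record qpath := QPath {
  qpath_val : vertex * seq arrow;
  qpathP : is_path qpath_val.1 qpath_val.2 }.
HB.instance Definition _ := [isSub for qpath_val].
HB.instance Definition _ := [Choice of qpath by <:].

Definition porig (p : qpath) : vertex := (val p).1.
Definition pterm (p : qpath) : vertex := endpoint (val p).1 (val p).2.

Definition triv (v : vertex) : qpath := @QPath (v, [::]) isT.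
Definition qarrow (x : arrow) : qpath :=
  @QPath (src x, [:: x]) (introT andP (conj (eqxx (src x)) isT)).

Lemma is_path_cat v s t :
  is_path v (s ++ t) = is_path v s && is_path (endpoint v s) t.
Proof. by elim: s v => //= x s IHs v; rewrite IHs andbA. Qed.

Lemma endpoint_cat v s t : endpoint v (s ++ t) = endpoint (endpoint v s) t.
Proof. by elim: s v => //=. Qed.

Definition qcat (p r : qpath) : option qpath :=
  if pterm p == porig r then insub (porig p, (val p).2 ++ (val r).2) else None.

Lemma qcatE p r (pr : pterm p = porig r) :
  exists2 w, qcat p r = Some w & val w = (porig p, (val p).2 ++ (val r).2).
Proof.
rewrite /qcat pr eqxx; have [w _ vw|] :=
  insubP qpath (porig p, (val p).2 ++ (val r).2); first by exists w.
by rewrite /= is_path_cat -[endpoint _ _]/(pterm p) pr !qpathP.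
Qed.

Lemma qcatN p r : pterm p != porig r -> qcat p r = None.
Proof. by rewrite /qcat => /negbTE ->. Qed.

Lemma qcatA p r s :
  obind (fun w => qcat w s) (qcat p r) = obind (qcat p) (qcat r s).
Proof.
have pt p' r' w : pterm p' = porig r' -> val w = (porig p', (val p').2 ++ (val r').2) ->
   porig w = porig p' /\ pterm w = pterm r'.
  move=> e ew; rewrite /porig /pterm ew /= endpoint_cat; split=> //.
  by rewrite -[endpoint _ (val p').2]/(pterm p') e.
have [pr|pr] := eqVneq (pterm p) (porig r); last first.
  rewrite (qcatN pr) /=; have [rs|/qcatN -> //] := eqVneq (pterm r) (porig s).
  have [w -> /(pt _ _ _ rs)[ow _] /=] := qcatE rs.
  by rewrite qcatN // ow.
have [w ew vw] := qcatE pr; rewrite ew /=; have [ow tw] := pt _ _ _ pr vw.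
have [rs|rs] := eqVneq (pterm r) (porig s); last first.
  by rewrite (qcatN rs) /= qcatN // tw.
have [z ez vz] := qcatE rs; rewrite ez /=; have [oz tz] := pt _ _ _ rs vz.
have ws : pterm w = porig s by rewrite tw.
have pz : pterm p = porig z by rewrite oz.
have [x -> vx] := qcatE ws; have [y -> vy] := qcatE pz.
by congr Some; apply: val_inj; rewrite vx vy /= vw vz ow /= catA.
Qed.

Lemma qcat_trivl v p : qcat (triv v) p = if v == porig p then Some p else None.
Proof.
have [e|e] := eqVneq v (porig p); last by rewrite qcatN.
have [w -> vw] := @qcatE (triv v) p e; congr Some; apply: val_inj.
by rewrite vw /= /porig /= e; case: p {e vw} => [[]].
Qed.

Lemma qcat_trivr v p : qcat p (triv v) = if v == pterm p then Some p else None.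
Proof.
rewrite eq_sym; have [e|e] := eqVneq (pterm p) v; last by rewrite qcatN.
have [w -> vw] := @qcatE p (triv v) e; congr Some; apply: val_inj.
by rewrite vw /= cats0; case: p {e vw} => [[]].
Qed.

Lemma qcat_eq_triv v p r :
  (qcat p r == Some (triv v)) = (p == triv v) && (r == triv v).
Proof.
apply/eqP/andP => [|[/eqP -> /eqP ->]]; last by rewrite qcat_trivl eqxx.
have [pr|/qcatN -> //] := eqVneq (pterm p) (porig r).
have [w -> vw] := qcatE pr => -[ew]; move: vw pr; rewrite ew /=.
case: p {ew} => [[vp [|? ?]] Hp] //; case: r => [[vr [|? ?]] Hr] //=.
by rewrite /porig /pterm /= => -[e1] e2; rewrite -!val_eqE /= -e2 -e1.
Qed.

Section PathAlgebra.
Variable k : fieldType.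

Definition pathalg := {malg k[qpath]}.
HB.instance Definition _ := GRing.Lmodule.on pathalg.

Fact pgen_key : unit. Proof. by []. Qed.
Definition pgen : qpath -> pathalg := locked_with pgen_key (fun p => << p >>).
Canonical pgen_unlockable := [unlockable fun pgen].

Definition pbas (o : option qpath) : pathalg := if o is Some p then pgen p else 0.

Fact pmul_key : unit. Proof. by []. Qed.
Definition pmul : pathalg -> pathalg -> pathalg :=
  locked_with pmul_key
    (fun x y => lin_ext (fun p => lin_ext (fun r => pbas (qcat p r)) y) x).
Canonical pmul_unlockable := [unlockable fun pmul].

Definition pone : pathalg := pgen (triv V1) + pgen (triv V2).

Fact pmul_linearl y : linear (pmul^~ y).
Proof. by rewrite [pmul]unlock; apply: lin_ext_linear. Qed.

Fact pmul_linearr x : linear (pmul x).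
Proof.
move=> c y z; rewrite [pmul]unlock !lin_extE scaler_sumr -big_split /=.
by apply: eq_bigr => p _; rewrite lin_ext_linear scalerDr !scalerA mulrC.
Qed.

Lemma pmulDl : left_distributive pmul +%R.
Proof. by move=> x y z; have := pmul_linearl z 1 x y; rewrite !scale1r. Qed.
Lemma pmulDr : right_distributive pmul +%R.
Proof. by move=> x y z; have := pmul_linearr x 1 y z; rewrite !scale1r. Qed.
Lemma pmul0l y : pmul 0 y = 0.
Proof. by apply: (addrI (pmul 0 y)); rewrite -pmulDl !addr0. Qed.
Lemma pmul0r y : pmul y 0 = 0.
Proof. by apply: (addrI (pmul y 0)); rewrite -pmulDr !addr0. Qed.
Lemma pscaleAl c x y : c *: pmul x y = pmul (c *: x) y.
Proof. by have := pmul_linearl y c x 0; rewrite pmul0l !addr0. Qed.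
Lemma pscaleAr c x y : c *: pmul x y = pmul x (c *: y).
Proof. by have := pmul_linearr x c y 0; rewrite pmul0r !addr0. Qed.

Lemma pmulU p r : pmul (pgen p) (pgen r) = pbas (qcat p r).
Proof. by rewrite [pmul]unlock [pgen in LHS]unlock !lin_extU. Qed.

Lemma path_ind (P : pathalg -> Prop) :
  P 0 -> (forall x y, P x -> P y -> P (x + y)) ->
  (forall (c : k) p, P (pgen p) -> P (c *: pgen p)) ->
  (forall p, P (pgen p)) -> forall x, P x.
Proof.
move=> P0 PD PZ PU x; rewrite [x]monalgE; elim/big_ind: _ => // p _.
have -> : << x@_p *g p >> = x@_p *: pgen p :> pathalg.
  by rewrite unlock; apply/malgP => q; rewrite mcoeffZ !mcoeffU mulrnAr mulr1.
exact: PZ.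
Qed.

Lemma mcoeff_pgen p r : (pgen p)@_r = (p == r)%:R.
Proof. by rewrite unlock mcoeffU. Qed.

Fact pmulA : associative pmul.
Proof.
move=> x y z; elim/path_ind: x => [|x x' Hx Hx'|c p Hp|p].
- by rewrite !pmul0l.
- by rewrite !pmulDl Hx Hx'.
- by rewrite -!pscaleAl Hp.
elim/path_ind: y => [|y y' Hy Hy'|c r Hr|r].
- by rewrite pmul0r !pmul0l pmul0r.
- by rewrite pmulDr !pmulDl pmulDr Hy Hy'.
- by rewrite -!(pscaleAl, pscaleAr) Hr.
elim/path_ind: z => [|z z' Hz Hz'|c s Hs|s].
- by rewrite !pmul0r.
- by rewrite !pmulDr Hz Hz'.
- by rewrite -!pscaleAr Hs.
rewrite !pmulU; have := qcatA p r s.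
case: (qcat p r) => [w|]; case: (qcat r s) => [w'|] /= e;
  by rewrite ?(pmul0l, pmul0r) ?pmulU -?e // e.
Qed.

Fact pmul1l : left_id pone pmul.
Proof.
elim/path_ind => [|x y Hx Hy|c p Hp|p]; first by rewrite pmul0r.
- by rewrite pmulDr Hx Hy.
- by rewrite -pscaleAr Hp.
by rewrite pmulDl !pmulU !qcat_trivl; case: porig; rewrite /= ?add0r ?addr0.
Qed.

Fact pmul1r : right_id pone pmul.
Proof.
elim/path_ind => [|x y Hx Hy|c p Hp|p]; first by rewrite pmul0l.
- by rewrite pmulDl Hx Hy.
- by rewrite -pscaleAl Hp.
by rewrite pmulDr !pmulU !qcat_trivr; case: pterm; rewrite /= ?add0r ?addr0.
Qed.

Fact pone_neq0 : pone != 0.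
Proof.
apply/eqP => /(congr1 (mcoeff (triv V1))) /eqP.
by rewrite mcoeffD !mcoeff_pgen mcoeff0 eqxx mulr1n addr0 oner_eq0.
Qed.

HB.instance Definition _ := GRing.Zmodule_isNzRing.Build pathalg
  pmulA pmul1l pmul1r pmulDl pmulDr pone_neq0.
HB.instance Definition _ := GRing.Lmodule_isLalgebra.Build k pathalg pscaleAl.
HB.instance Definition _ := GRing.Lalgebra_isAlgebra.Build k pathalg pscaleAr.

Lemma mcoeff_triv v (x y : pathalg) :
  (x * y)@_(triv v) = x@_(triv v) * y@_(triv v).
Proof.
elim/path_ind: x => [|x x' Hx Hx'|c p Hp|p].
- by rewrite mul0r !mcoeff0 mul0r.
- by rewrite mulrDl !mcoeffD Hx Hx' mulrDl.
- by rewrite -scalerAl !mcoeffZ Hp mulrA.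
elim/path_ind: y => [|y y' Hy Hy'|c r Hr|r].
- by rewrite mulr0 !mcoeff0 mulr0.
- by rewrite mulrDr !mcoeffD Hy Hy' mulrDr.
- by rewrite -scalerAr !mcoeffZ Hr mulrCA.
rewrite [_ * _]pmulU !mcoeff_pgen -natrM mulnb -qcat_eq_triv.
by case: qcat => [w|]; rewrite /= ?mcoeff_pgen ?mcoeff0.
Qed.

End PathAlgebra.

Section QuiverAlgebra.
Variables (k : fieldType) (q : k).

Definition ve (v : vertex) : pathalg k := pgen k (triv v).
Definition ar (x : arrow) : pathalg k := pgen k (qarrow x).

Definition relators : seq (pathalg k) :=
  [:: ar Aa * ar Aa; ar Ab * ar Ab;
      ar Aa * ar Ab - q *: (ar Ab * ar Aa); ar Aa * ar Ac].

(* The span of these elements is the two-sided ideal I_q. *)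
Definition ideal_gen (x : pathalg k) : Prop :=
  exists u s v, s \in relators /\ x = u * s * v.

Definition Lambda := lquot ideal_gen.
HB.instance Definition _ := GRing.Lmodule.on Lambda.

Definition Lpi : pathalg k -> Lambda := lpi ideal_gen.
HB.instance Definition _ := GRing.Linear.on Lpi.

Lemma IqMl x y : y \in lspan ideal_gen -> x * y \in lspan ideal_gen.
Proof.
case/asboolP => t Ht ->; rewrite mulr_sumr big_seq.
apply: rpred_sum => z /Ht[u [s [v [sR ->]]]].
rewrite -scalerAr; apply: rpredZ; apply: span_gen.
by exists (x * u), s, v; rewrite !mulrA.
Qed.

Lemma IqMr x y : x \in lspan ideal_gen -> x * y \in lspan ideal_gen.
Proof.
case/asboolP => t Ht ->; rewrite mulr_suml big_seq.
apply: rpred_sum => z /Ht[u [s [v [sR ->]]]].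
rewrite -scalerAl; apply: rpredZ; apply: span_gen.
by exists u, s, (v * y); rewrite !mulrA.
Qed.

Definition Lone : Lambda := Lpi 1.
Definition Lmul (x y : Lambda) : Lambda := Lpi (lrepr x * lrepr y).

Lemma Lpi_ind (P : Lambda -> Prop) : (forall x, P (Lpi x)) -> forall x, P x.
Proof. by move=> Px x; rewrite -[x]lreprK; apply: Px. Qed.

Lemma LmulE x y : Lmul (Lpi x) (Lpi y) = Lpi (x * y).
Proof.
apply: lpi_eq; set x' := lrepr _; set y' := lrepr _.
have -> : x' * y' - x * y = (x' - x) * y' + x * (y' - y).
  by rewrite mulrBl mulrBr addrA subrK.
by apply: rpredD; [apply: IqMr | apply: IqMl]; apply: lpi_inj; rewrite lreprK.
Qed.

Fact LmulA : associative Lmul.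
Proof.
by elim/Lpi_ind=> x; elim/Lpi_ind=> y; elim/Lpi_ind=> z; rewrite !LmulE mulrA.
Qed.
Fact Lmul1l : left_id Lone Lmul.
Proof. by elim/Lpi_ind=> x; rewrite LmulE mul1r. Qed.
Fact Lmul1r : right_id Lone Lmul.
Proof. by elim/Lpi_ind=> x; rewrite LmulE mulr1. Qed.
Fact LmulDl : left_distributive Lmul +%R.
Proof.
elim/Lpi_ind=> x; elim/Lpi_ind=> y; elim/Lpi_ind=> z.
by rewrite -[Lpi x + _]linearD !LmulE mulrDl linearD.
Qed.
Fact LmulDr : right_distributive Lmul +%R.
Proof.
elim/Lpi_ind=> x; elim/Lpi_ind=> y; elim/Lpi_ind=> z.
by rewrite -[Lpi y + _]linearD !LmulE mulrDr linearD.
Qed.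

Fact Lone_neq0 : Lone != 0.
Proof.
apply/eqP => e; have /lpi_inj : Lpi 1 = Lpi 0 by rewrite linear0.
rewrite subr0 => /asboolP[t Ht /(congr1 (mcoeff (triv V1)))].
rewrite mcoeffD !mcoeff_pgen eqxx mulr1n addr0 raddf_sum big_seq big1 /=.
  by move/eqP; rewrite oner_eq0.
move=> z /Ht[u [s [v [sR ->]]]]; rewrite mcoeffZ !mcoeff_triv.
suff -> : s@_(triv V1) = 0 by rewrite mulr0 mul0r mulr0.
have arr0 x : (ar x)@_(triv V1) = 0 by rewrite mcoeff_pgen; case: x.
have arr2 x y : (ar x * ar y)@_(triv V1) = 0.
  by rewrite mcoeff_triv arr0 mul0r.
move: sR; rewrite !inE => /or4P[]/eqP ->; try exact: arr2.
have cB (x y : pathalg k) : (x - y)@_(triv V1) = x@_(triv V1) - y@_(triv V1).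
  exact: mcoeffB.
have cZ c (x : pathalg k) : (c *: x)@_(triv V1) = c * x@_(triv V1).
  exact: mcoeffZ.
by rewrite cB cZ !arr2 mulr0 subr0.
Qed.

HB.instance Definition _ := GRing.Zmodule_isNzRing.Build Lambda
  LmulA Lmul1l Lmul1r LmulDl LmulDr Lone_neq0.

Fact LscaleAl (c : k) (x y : Lambda) : c *: (x * y) = (c *: x) * y.
Proof.
elim/Lpi_ind: x => x; elim/Lpi_ind: y => y.
by rewrite -[c *: Lpi x]linearZ [LHS]/(c *: Lmul _ _) [RHS]LmulE LmulE -scalerAl linearZ.
Qed.
HB.instance Definition _ := GRing.Lmodule_isLalgebra.Build k Lambda LscaleAl.

Fact LscaleAr (c : k) (x y : Lambda) : c *: (x * y) = x * (c *: y).
Proof.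
elim/Lpi_ind: x => x; elim/Lpi_ind: y => y.
by rewrite -[c *: Lpi y]linearZ [LHS]/(c *: Lmul _ _) [RHS]LmulE LmulE -scalerAr linearZ.
Qed.
HB.instance Definition _ := GRing.Lalgebra_isAlgebra.Build k Lambda LscaleAr.

Fact Lpi_monoid : monoid_morphism Lpi.
Proof. by split=> // x y; rewrite -LmulE. Qed.
HB.instance Definition _ :=
  GRing.isMonoidMorphism.Build (pathalg k) Lambda Lpi Lpi_monoid.

Definition Le (v : vertex) : Lambda := Lpi (ve v).
Definition La : Lambda := Lpi (ar Aa).
Definition Lb : Lambda := Lpi (ar Ab).
Definition Lc : Lambda := Lpi (ar Ac).

End QuiverAlgebra.

Section Resolution.
Variables (k : fieldType) (q : k).
Notation L := (Lambda q).

(* The elements f^n_r of kQ; the recursion also yields the values prescribed for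
   n = 1, 2. They enter the resolution only through their origin and terminal
   vertices origv n r and termv n r, see fres_uniform. *)
Fixpoint fres (n r : nat) : pathalg k :=
  if n is m.+1 then
    if r == 0%N then ar k Aa ^+ m.+1
    else if r == m.+1 then ar k Ab ^+ m.+1
    else if r == m.+2 then ar k Aa ^+ m * ar k Ac
    else fres m r.-1 * ar k Ab + (- q) ^+ r *: (fres m r * ar k Aa)
  else ve k (if r == 0%N then V1 else V2).

Definition origv (n r : nat) : vertex := if (n == 0%N) && (r == 1%N) then V2 else V1.
Definition termv (n r : nat) : vertex := if r == n.+1 then V2 else V1.

Lemma ve_ar x : ve k (src x) * ar k x = ar k x.
Proof. by rewrite [LHS]pmulU qcat_trivl eqxx. Qed.
Lemma ar_ve x : ar k x * ve k (tgt x) = ar k x.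
Proof. by rewrite [LHS]pmulU qcat_trivr eqxx. Qed.

Lemma fres_uniform n r : (r <= n.+1)%N ->
  ve k (origv n r) * fres n r = fres n r /\ fres n r * ve k (termv n r) = fres n r.
Proof.
have veX x m : src x = V1 -> ve k V1 * ar k x ^+ m.+1 = ar k x ^+ m.+1.
  by move=> <-; rewrite exprS mulrA ve_ar.
have Xve x m : tgt x = V1 -> ar k x ^+ m.+1 * ve k V1 = ar k x ^+ m.+1.
  by move=> <-; rewrite exprSr -mulrA ar_ve.
elim: n r => [|n IHn] r.
  case: r => [|[|//]] _; rewrite /origv /termv /=; split;
  by rewrite [LHS]pmulU qcat_trivl eqxx.
rewrite /origv /termv /= => ler.
have [->|r0] := eqVneq r 0%N; first by rewrite /= veX ?Xve.
have [->|rn] := eqVneq r n.+1; first by rewrite eqSS ltn_eqF // veX ?Xve.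
have [_|rn'] := eqVneq r n.+2.
  split; last by rewrite -mulrA ar_ve.
  by case: n {IHn ler rn} => [|n]; rewrite ?expr0 ?mul1r ?ve_ar // mulrA veX.
have lern : (r <= n)%N by move: ler; rewrite leq_eqVlt (negPf rn') ltnS leq_eqVlt (negPf rn).
have [e1 _] := IHn r.-1 (leq_trans (leq_pred _) (leqW lern)).
have [e2 _] := IHn r (leqW lern).
have o1 : origv n r.-1 = V1 by rewrite /origv; case: n r {IHn} r0 lern {e1 e2 ler rn rn'} => [|n] [|r].
have o2 : origv n r = V1 by rewrite /origv; case: n r {IHn} r0 lern {e1 e2 ler rn rn' o1} => [|n] [|r].
rewrite o1 in e1; rewrite o2 in e2; split.
  by rewrite mulrDr -scalerAr !mulrA e1 e2.
by rewrite mulrDl -scalerAl -!mulrA -[V1]/(tgt Ab) ar_ve -[tgt Ab]/(tgt Aa) ar_ve.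
Qed.

Definition bimul (x y : L) : tensor L L -> tensor L L :=
  tens_lift (fun u v => tens (x * u) (v * y)).
Definition corner (e e' : L) : tensor L L -> tensor L L :=
  tens_lift (fun u v => tens (u * e) (e' * v)).

Lemma tens_map_bilin (f g : L -> L) : linear f -> linear g ->
  bilin (fun u v => tens (f u) (g v)).
Proof.
have [tl tr] := @tens_bilin k L L.
by move=> lf lg; split=> [v|u] c x y; rewrite (lf, lg) (tl, tr).
Qed.

Fact mulr_lin (A : algType k) (x : A) : linear ( *%R x).
Proof. by move=> c y z; rewrite mulrDr scalerAr. Qed.
Fact mull_lin (A : algType k) (x : A) : linear ( *%R^~ x).
Proof. by move=> c y z; rewrite mulrDl scalerAl. Qed.

Lemma bimul_bilin x y : bilin (fun u v : L => tens (x * u) (v * y)).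
Proof. exact: tens_map_bilin (mulr_lin x) (mull_lin y). Qed.
Lemma corner_bilin x y : bilin (fun u v : L => tens (u * x) (y * v)).
Proof. exact: tens_map_bilin (mull_lin x) (mulr_lin y). Qed.

Lemma bimulE x y u v : bimul x y (tens u v) = tens (x * u) (v * y).
Proof. exact/tens_liftE/bimul_bilin. Qed.
Lemma cornerE x y u v : corner x y (tens u v) = tens (u * x) (y * v).
Proof. exact/tens_liftE/corner_bilin. Qed.
Lemma bimul_linear x y : linear (bimul x y).
Proof. exact/tens_lift_linear/bimul_bilin. Qed.
Lemma corner_linear x y : linear (corner x y).
Proof. exact/tens_lift_linear/corner_bilin. Qed.
HB.instance Definition _ x y :=
  GRing.isLinear.Build k (tensor L L) (tensor L L) _ (bimul x y) (bimul_linear x y).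
HB.instance Definition _ x y :=
  GRing.isLinear.Build k (tensor L L) (tensor L L) _ (corner x y) (corner_linear x y).

Lemma bimul_corner x y e e' z :
  bimul x y (corner e e' z) = corner e e' (bimul x y z).
Proof.
have cl (f g : {linear tensor L L -> tensor L L}) : linear (fun z => f (g z)).
  by move=> c u v; rewrite !linearP.
apply: (tens_ext (cl _ _) (cl _ _)) => u v.
rewrite -[LHS]/(bimul x y (corner e e' (tens u v))).
rewrite -[RHS]/(corner e e' (bimul x y (tens u v))).
by rewrite cornerE !bimulE cornerE !mulrA.
Qed.

(* L o (x) t L is the subspace of L (x) L fixed by u (x) v |-> u o (x) t v. *)
Definition kpred (n : nat) : pred {ffun 'I_n.+2 -> tensor L L} :=
  fun z => [forall r : 'I_n.+2, corner (Le q (origv n r)) (Le q (termv n r)) (z r) == z r].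

Fact kpred_submod n : submod_closed (@kpred n).
Proof.
split=> [|c x y /forallP Hx /forallP Hy]; apply/forallP => r; rewrite !ffunE.
  by rewrite linear0.
by rewrite corner_linear (eqP (Hx r)) (eqP (Hy r)).
Qed.
HB.instance Definition _ n :=
  GRing.isSubmodClosed.Build k _ (@kpred n) (@kpred_submod n).

Record K (n : nat) := MkK {
  kval : {ffun 'I_n.+2 -> tensor L L};
  kvalP : kval \in @kpred n }.
HB.instance Definition _ n := [isSub for @kval n].
HB.instance Definition _ n := [Choice of K n by <:].
HB.instance Definition _ n := [SubChoice_isSubLmodule of K n by <:].

Fact act_subproof n (x y : L) (z : K n) :
  [ffun r => bimul x y (kval z r)] \in @kpred n.
Proof.
by apply/forallP => r; rewrite ffunE -bimul_corner (eqP (forallP (kvalP z) r)).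
Qed.
(* The bimodule action x z y. *)
Definition act n (x : L) (z : K n) (y : L) : K n := MkK (act_subproof x y z).
Definition lact n (x : L) (z : K n) : K n := act x z 1.
Definition ract n (z : K n) (y : L) : K n := act 1 z y.

Lemma Le_idem v : Le q v * Le q v = Le q v.
Proof. by rewrite -rmorphM [ve k v * _]pmulU qcat_trivl eqxx. Qed.

Fact eps_subproof n r :
  [ffun i : 'I_n.+2 => if i == r :> nat
     then tens (Le q (origv n r)) (Le q (termv n r)) else 0] \in @kpred n.
Proof.
apply/forallP => i; rewrite ffunE.
have [->|_] := eqVneq (i : nat) r; last by rewrite linear0.
by rewrite cornerE !Le_idem.
Qed.
(* For r > n.+1 this is 0; such indices do not occur below. *)
Definition eps (n r : nat) : K n := MkK (eps_subproof n r).

Definition augm (z : K 0) : L :=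
  \sum_(r < 2) tens_lift (fun x y => x * y) (kval z r).

Definition kdelta (r s : nat) : k := if r == s then 1 else 0.

(* diffK_gen m r is d_n(eps^n_r) for n = m.+1. *)
Definition diffK_gen (m r : nat) : K m :=
  let n := m.+1 in
  if (r <= n)%N then
    (1 - kdelta n r) *:
      (lact (La q) (eps m r) + ((-1) ^+ (n - r) * q ^+ r) *: ract (eps m r) (La q))
    + (1 - kdelta r 0) *:
      ((- q) ^+ (n - r) *: lact (Lb q) (eps m r.-1)
       + (-1) ^+ n *: ract (eps m r.-1) (Lb q))
  else if n == 1%N then
    lact (Lc q) (eps m 1) - ract (eps m 0) (Lc q)
  else
    lact (La q) (eps m n) + (-1) ^+ n *: ract (eps m 0) (Lc q).

(* The bimodule map with eps m.+1 r |-> diffK_gen m r. *)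
Definition diffK (m : nat) (z : K m.+1) : K m :=
  \sum_(r < m.+3) tens_lift (fun x y => act x (diffK_gen m r) y) (kval z r).

Definition derivation (gamma : L -> L) : Prop :=
  linear gamma /\ forall x y, gamma (x * y) = gamma x * y + x * gamma y.

(* The cochain (l0 l1 l2) : K 1 -> L, eps 1 r |-> l_r, seen as a derivation. *)
Definition cochain_derivation (l0 l1 l2 : L) (gamma : L -> L) : Prop :=
  [/\ derivation gamma, gamma (Le q V1) = 0, gamma (Le q V2) = 0 &
      [/\ gamma (La q) = l0, gamma (Lb q) = l1 & gamma (Lc q) = l2]].

Definition leibniz (gamma : L -> L) (phi : forall n, K n -> K n) : Prop :=
  forall n r (x y : L), (r <= n.+1)%N ->
    phi n (act x (eps n r) y) =
      act (gamma x) (eps n r) y + act x (phi n (eps n r)) y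
      + act x (eps n r) (gamma y).

Definition derivation_operator (gamma : L -> L) (phi : forall n, K n -> K n) : Prop :=
  [/\ forall n, linear (phi n),
      forall n z, phi n (diffK z) = diffK (phi n.+1 z),
      forall z, augm (phi 0%N z) = gamma (augm z) &
      leibniz gamma phi].

(* phi is psi, given on the generators, regarded as a family of k-linear maps. *)
Definition leibniz_extension (gamma : L -> L) (psi : forall n, nat -> K n)
    (phi : forall n, K n -> K n) : Prop :=
  [/\ forall n, linear (phi n),
      forall n r, (r <= n.+1)%N -> phi n (eps n r) = psi n r &
      leibniz gamma phi].

Definition psi_eta (n r : nat) : K n :=
  if n == 0%N then 0
  else if (r <= n)%N then eps n r *+ (n - r)
  else eps n r *+ (n - 1).

(* (1 + (-1)^r) / 2 is read as an integer, 1 or 0 by the parity of r, so that it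
   makes sense in characteristic 2. *)
Definition psi_chi (n r : nat) : K n :=
  if n == 0%N then 0
  else if (r < n)%N then
    (~~ odd r)%:R *: ((-1) ^+ n.+1 *: lact (La q) (eps n r.+1))
    + ract (eps n r) (Lb q) *+ (n - r)
  else if r == n then 0
  else (lact (Lb q) (eps n r) + ract (eps n 1) (Lc q)) *+ (n - 1).

End Resolution.

Section BimoduleFacts.
Variables (k : fieldType) (q : k).
Notation L := (Lambda q).

Lemma bimul_bimul (x y x' y' : L) z :
  bimul x y (bimul x' y' z) = bimul (x * x') (y' * y) z.
Proof.
have cl (f g : {linear tensor L L -> tensor L L}) : linear (fun z => f (g z)).
  by move=> c u v; rewrite !linearP.
apply: (tens_ext (cl _ _) (bimul_linear _ _)) => u v.
rewrite -[LHS]/(bimul x y (bimul x' y' (tens u v))).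
by rewrite !bimulE !mulrA.
Qed.

Lemma bimul0 (x y : L) : bimul x y 0 = 0.
Proof. exact: linear0. Qed.

Lemma comb_linear (U M : lmodType k) (f g : U -> M) (c : k) :
  linear f -> linear g -> linear (fun z => c *: f z + g z).
Proof.
move=> lf lg c' u v; rewrite lf lg !scalerDr !scalerA (mulrC c).
by rewrite addrACA.
Qed.

Lemma bimul_bilinear (z : tensor L L) : bilin (fun x y : L => bimul x y z).
Proof.
have [tl tr] := @tens_bilin k L L.
split=> [y|x] c u v; move: z.
  apply: (tens_ext (bimul_linear _ _) (comb_linear c (bimul_linear _ _) (bimul_linear _ _))) => a b.
  by rewrite !bimulE mull_lin tl.
apply: (tens_ext (bimul_linear _ _) (comb_linear c (bimul_linear _ _) (bimul_linear _ _))) => a b.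
by rewrite !bimulE mulr_lin tr.
Qed.

Lemma act_linear n (x y : L) : linear (fun z : K q n => act x z y).
Proof.
move=> c u v; apply: val_inj; apply/ffunP => i.
by rewrite !ffunE bimul_linear.
Qed.

Lemma act_bilinear n (z : K q n) : bilin (fun x y : L => act x z y).
Proof.
split=> [y|x] c u v; apply: val_inj; apply/ffunP => i; rewrite !ffunE.
  by have [-> _] := bimul_bilinear (kval z i).
by have [_ ->] := bimul_bilinear (kval z i).
Qed.

Lemma act_act n (x y x' y' : L) (z : K q n) :
  act x (act x' z y') y = act (x * x') z (y' * y).
Proof. by apply: val_inj; apply/ffunP => i; rewrite !ffunE bimul_bimul. Qed.

Lemma act_eps n r (x y : L) :
  act (x * Le q (origv n r)) (eps q n r) (Le q (termv n r) * y) = act x (eps q n r) y.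
Proof.
apply: val_inj; apply/ffunP => i; rewrite !ffunE.
have [_|_] := eqVneq (i : nat) r; last by rewrite !bimul0.
by rewrite !bimulE -mulrA Le_idem mulrA Le_idem.
Qed.

Lemma LeMar v x : Le q v * Lpi q (ar k x) = if v == src x then Lpi q (ar k x) else 0.
Proof.
rewrite -rmorphM [ve k v * _]pmulU qcat_trivl -[porig _]/(src x).
by case: eqP => _ //=; rewrite linear0.
Qed.

Lemma arMLe v x : Lpi q (ar k x) * Le q v = if v == tgt x then Lpi q (ar k x) else 0.
Proof.
rewrite -rmorphM [_ * ve k v]pmulU qcat_trivr -[pterm _]/(tgt x).
by case: eqP => _ //=; rewrite linear0.
Qed.

Lemma relation u : u \in relators q -> Lpi q u = 0.
Proof.
move=> uR; rewrite -(linear0 (Lpi q)); apply: lpi_eq; rewrite subr0.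
by apply: span_gen; exists 1, u, 1; rewrite mul1r mulr1.
Qed.

Lemma act_eps_corner m s (e x y e' : L) :
  e * (x * Le q (origv m s)) = x * Le q (origv m s) ->
  Le q (termv m s) * y * e' = Le q (termv m s) * y ->
  act e (act x (eps q m s) y) e' = act x (eps q m s) y.
Proof.
by move=> ex ye; rewrite act_act -act_eps mulrA -mulrA ex ye act_eps.
Qed.

Lemma linear_zero (U M : lmodType k) (f : U -> M) : linear f -> f 0 = 0.
Proof.
by move=> lf; have := lf (-1) 0 0; rewrite scaler0 addr0 scaleN1r addNr.
Qed.

Lemma diffK_gen_corner m r : (r <= m.+2)%N ->
  act (Le q (origv m.+1 r)) (diffK_gen q m r) (Le q (termv m.+1 r)) = diffK_gen q m r.
Proof.
move=> ler; set o := Le q _; set t := Le q _.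
have [A lA AE] : exists2 A : K q m -> K q m, linear A & forall z, A z = act o z t.
  by exists (fun z => act o z t); [apply: act_linear|].
have AZ c z : A (c *: z) = c *: A z by apply: GRing.scalable_linear lA _ _.
have AD z w : A (z + w) = A z + A w by have [_ ->] := GRing.semilinear_linear lA.
have AZD c z w : A z = z -> A w = w -> A (z + c *: w) = z + c *: w.
  by move=> ez ew; rewrite AD AZ ez ew.
have AD1 z w : A z = z -> A w = w -> A (z + w) = z + w by move=> ez ew; rewrite AD ez ew.
have AZ1 c z : c = 0 \/ A z = z -> A (c *: z) = c *: z.
  by rewrite AZ => -[->|->]; rewrite ?scale0r.
rewrite -AE.
have o1 : o = Le q V1 by [].
rewrite /diffK_gen; case: leqP => [le_r|gt_r].
  have t1 : t = Le q V1 by rewrite /t /termv ltn_eqF.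
  have corner s x : (s <= m)%N -> (x == Aa) || (x == Ab) ->
      A (lact (Lpi q (ar k x)) (eps q m s)) = lact (Lpi q (ar k x)) (eps q m s) /\
      A (ract (eps q m s) (Lpi q (ar k x))) = ract (eps q m s) (Lpi q (ar k x)).
    move=> le_s xab.
    have os : origv m s = V1 by rewrite /origv; case: (m) (s) le_s => [|?] [|[]].
    have ts : termv m s = V1 by rewrite /termv ltn_eqF.
    have tx : tgt x = V1 by case: x xab.
    split; rewrite AE; apply: act_eps_corner; rewrite ?os ?ts ?o1 ?t1.
    - by rewrite arMLe tx LeMar.
    - by rewrite mulr1 Le_idem.
    - by rewrite mul1r Le_idem.
    - by rewrite LeMar arMLe tx.
  apply: AD1; apply: AZ1.
    rewrite /kdelta; have [<-|ne] := eqVneq m.+1 r; first by left; rewrite subrr.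
    have lrm : (r <= m)%N by rewrite -ltnS ltn_neqAle eq_sym ne.
    by right; have [ea ea'] := corner r Aa lrm isT; apply: AZD.
  rewrite /kdelta; have [->|ne] := eqVneq r 0%N; first by left; rewrite subrr.
  have lrm : (r.-1 <= m)%N by case: (r) ne le_r.
  by right; have [eb eb'] := corner r.-1 Ab lrm isT; apply: AZD; rewrite // AZ eb.
have er : r = m.+2 by apply/eqP; rewrite eqn_leq ler.
have t2 : t = Le q V2 by rewrite /t er /termv eqxx.
case: eqP => [[em]|nm].
  rewrite -[- ract _ _]scaleN1r; apply: AZD; rewrite AE; apply: act_eps_corner;
    rewrite ?o1 ?t2 em /origv /termv /=.
  - by rewrite arMLe LeMar.
  - by rewrite mulr1 Le_idem.
  - by rewrite mul1r Le_idem.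
  - by rewrite LeMar arMLe.
apply: AZD; rewrite AE; apply: act_eps_corner; rewrite ?o1 ?t2 /origv /termv /= ?eqxx.
- by case: (m) nm => [//|m'] _ /=; rewrite arMLe LeMar.
- by rewrite mulr1 Le_idem.
- by rewrite andbF mul1r Le_idem.
- by rewrite LeMar arMLe.
Qed.

Lemma diffK_eps m r (x y : L) : (r <= m.+2)%N ->
  diffK (act x (eps q m.+1 r) y) = act x (diffK_gen q m r) y.
Proof.
move=> lt_r; pose i0 : 'I_m.+3 := Ordinal (lt_r : (r < m.+3)%N).
rewrite /diffK (bigD1 i0) //= big1 ?addr0; last first.
  move=> i ne_i; rewrite !ffunE.
  rewrite (negPf ne_i : (i == r :> nat) = false) bimul0.
  exact: linear_zero (tens_lift_linear (act_bilinear _)).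
rewrite !ffunE eqxx bimulE (tens_liftE (act_bilinear _)) -[in RHS]diffK_gen_corner //.
by rewrite act_act.
Qed.

End BimoduleFacts.

(* Main.v *)
Require Import Defs.
From mathcomp Require Import all_boot all_algebra zify ssrAC.
From mathcomp Require Import boolp.
Import GRing.Theory.
Local Open Scope ring_scope.

(* K_n is spanned by the x eps_r y, so a Leibniz extension is determined by its
   values on generators, and it exists as soon as gamma kills the idempotents and
   each value lies in the corner of its generator. The Leibniz rule then holds for
   x z y with z arbitrary; since d is a bimodule map, the chain condition reduces
   to phi (d eps_r) = d (psi eps_r). For eta this holds because d is homogeneous
   for the grading that counts the letters a; for chi it is a direct computation
   with ab = ba, a^2 = b^2 = ac = 0. *)

Set Implicit Arguments.
Unset Strict Implicit.
Unset Printing Implicit Defensive.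

(** * Functions known only to satisfy the predicate [linear] *)

Section LinearFunctions.
Variables (k : fieldType) (U M : lmodType k) (f : U -> M).
Hypothesis lf : linear f.

Lemma lin_add x y : f (x + y) = f x + f y.
Proof. by have [_ ->] := GRing.semilinear_linear lf. Qed.

Lemma lin_scale c x : f (c *: x) = c *: f x.
Proof. exact: GRing.scalable_linear lf _ _. Qed.

Lemma lin_opp x : f (- x) = - f x.
Proof. by rewrite -scaleN1r lin_scale scaleN1r. Qed.

Lemma lin_sum I (r : seq I) (P : pred I) F :
  f (\sum_(i <- r | P i) F i) = \sum_(i <- r | P i) f (F i).
Proof. by apply: (big_morph f lin_add); apply: linear_zero. Qed.

End LinearFunctions.

(** * Generation of K_n by the x eps_r y, with d and the augmentation on generators *)

Section Bimodules.
Variables (k : fieldType) (q : k).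
Notation L := (Lambda q).
Implicit Types (x y : L).

Lemma actDl n (z : K q n) x x' y : act (x + x') z y = act x z y + act x' z y.
Proof. exact: lin_add ((act_bilinear z).1 y) _ _. Qed.
Lemma actDm n (z z' : K q n) x y : act x (z + z') y = act x z y + act x z' y.
Proof. exact: lin_add (act_linear x y) _ _. Qed.
Lemma actDr n (z : K q n) x y y' : act x z (y + y') = act x z y + act x z y'.
Proof. exact: lin_add ((act_bilinear z).2 x) _ _. Qed.
Lemma actZl n (z : K q n) c x y : act (c *: x) z y = c *: act x z y.
Proof. exact: lin_scale ((act_bilinear z).1 y) _ _. Qed.
Lemma actZm n (z : K q n) c x y : act x (c *: z) y = c *: act x z y.
Proof. exact: lin_scale (act_linear x y) _ _. Qed.
Lemma actZr n (z : K q n) c x y : act x z (c *: y) = c *: act x z y.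
Proof. exact: lin_scale ((act_bilinear z).2 x) _ _. Qed.
Lemma act0l n (z : K q n) y : act 0 z y = 0.
Proof. exact: linear_zero ((act_bilinear z).1 y). Qed.
Lemma act0m n x y : act x (0 : K q n) y = 0.
Proof. exact: linear_zero (act_linear x y). Qed.
Lemma act0r n (z : K q n) x : act x z 0 = 0.
Proof. exact: linear_zero ((act_bilinear z).2 x). Qed.

Lemma actMn n (z : K q n) x y i : act x (z *+ i) y = act x z y *+ i.
Proof. by rewrite -scaler_nat actZm scaler_nat. Qed.

(** The bimodule map from the free bimodule that sends the tensor of 1 and 1 to z. *)
Definition act_lin n (z : K q n) : tensor L L -> K q n :=
  tens_lift (fun x y => act x z y).

Lemma act_lin_linear n (z : K q n) : linear (act_lin z).
Proof. exact: tens_lift_linear (act_bilinear z). Qed.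

Lemma act_linE n (z : K q n) x y : act_lin z (tens x y) = act x z y.
Proof. exact: tens_liftE (act_bilinear z) _ _. Qed.

Lemma kval_linear n (i : 'I_n.+2) : linear (fun z : K q n => kval z i).
Proof. by move=> c u v; rewrite !ffunE. Qed.

Lemma act_lin_eps_kval n r (i : 'I_n.+2) (t : tensor L L) :
  kval (act_lin (eps q n r) t) i =
  if i == r :> nat then corner (Le q (origv n r)) (Le q (termv n r)) t else 0.
Proof.
have l1 : linear (fun t => kval (act_lin (eps q n r) t) i).
  by move=> c u v; rewrite act_lin_linear kval_linear.
have l2 : linear (fun t : tensor L L =>
    if i == r :> nat then corner (Le q (origv n r)) (Le q (termv n r)) t else 0).
  by move=> c u v; case: ifP => _; rewrite ?corner_linear ?scaler0 ?addr0.
apply: (tens_ext l1 l2) => u v.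
rewrite act_linE !ffunE; case: ifP => _; last exact: bimul0.
by rewrite bimulE cornerE.
Qed.

(** Membership in K_n says that each component is fixed by its corner projection, and that
    projection is the r-th component of [act_lin (eps q n r)]. *)
Lemma eps_decomp n (z : K q n) :
  z = \sum_(r < n.+2) act_lin (eps q n r) (kval z r).
Proof.
apply: val_inj; apply/ffunP => i.
rewrite (lin_sum (@kval_linear n i)) (bigD1 i) //= big1 ?addr0.
  by rewrite act_lin_eps_kval eqxx (eqP (forallP (kvalP z) i)).
by move=> j ji; rewrite act_lin_eps_kval eq_sym (negPf ji : (j == i :> nat) = false).
Qed.

(** In each summand of [eps_decomp], linear maps on tensors are compared on pure tensors. Later
    identities on K_n are reduced to generators this way. *)
Lemma K_ext n (M : lmodType k) (f g : K q n -> M) : linear f -> linear g ->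
  (forall r x y, (r <= n.+1)%N ->
     f (act x (eps q n r) y) = g (act x (eps q n r) y)) -> f =1 g.
Proof.
move=> lf lg fg z; rewrite (eps_decomp z) (lin_sum lf) (lin_sum lg).
apply: eq_bigr => r _; set e := eps q n r.
have l1 : linear (fun t => f (act_lin e t)).
  by move=> c u v; rewrite act_lin_linear lf.
have l2 : linear (fun t => g (act_lin e t)).
  by move=> c u v; rewrite act_lin_linear lg.
by apply: (tens_ext l1 l2) => u v; rewrite act_linE; apply: fg; rewrite -ltnS.
Qed.

Lemma diffK_linear m : linear (@diffK k q m).
Proof.
move=> c u v; rewrite /diffK scaler_sumr -big_split /=; apply: eq_bigr => r _.
by rewrite kval_linear (tens_lift_linear (act_bilinear _)).
Qed.

Lemma diffK_act m x (z : K q m.+1) y : diffK (act x z y) = act x (diffK z) y.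
Proof.
have l1 : linear (fun z : K q m.+1 => diffK (act x z y)).
  by move=> c u v; rewrite act_linear diffK_linear.
have l2 : linear (fun z : K q m.+1 => act x (diffK z) y).
  by move=> c u v; rewrite diffK_linear act_linear.
by apply: (K_ext l1 l2) => r x' y' lr; rewrite act_act !diffK_eps // act_act.
Qed.

Lemma act11 n (z : K q n) : act 1 z 1 = z.
Proof.
have l1 : linear (fun z : K q n => act 1 z 1) by apply: act_linear.
have l2 : linear (fun z : K q n => z) by [].
by apply: (K_ext l1 l2) => r x y _; rewrite act_act mul1r mulr1.
Qed.

Lemma diffK_gens m r : (r <= m.+2)%N -> diffK (eps q m.+1 r) = diffK_gen q m r.
Proof. by move=> lr; rewrite -[eps q _ _]act11 diffK_eps // act11. Qed.

Lemma augm_eps r x y : (r <= 1)%N ->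
  augm (act x (eps q 0 r) y) = x * Le q (origv 0 r) * (Le q (termv 0 r) * y).
Proof.
have mb : bilin (fun u v : L => u * v).
  by split=> [v|u]; [apply: mull_lin|apply: mulr_lin].
move=> lr; pose i0 : 'I_2 := Ordinal (lr : (r < 2)%N).
rewrite /augm (bigD1 i0) //= big1 ?addr0 => [|i ne_i]; rewrite !ffunE.
  by rewrite eqxx bimulE (tens_liftE mb).
rewrite (negPf ne_i : (i == r :> nat) = false) bimul0.
exact: linear_zero (tens_lift_linear mb).
Qed.

Lemma augm_linear : linear (@augm k q).
Proof.
have mb : bilin (fun u v : L => u * v).
  by split=> [v|u]; [apply: mull_lin|apply: mulr_lin].
move=> c u v; rewrite /augm scaler_sumr -big_split /=; apply: eq_bigr => r _.
by rewrite kval_linear (tens_lift_linear mb).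
Qed.

End Bimodules.

(** * Maps on K determined by the Leibniz rule *)

Section LeibnizExtensions.
Variables (k : fieldType) (q : k) (gamma : Lambda q -> Lambda q).
Notation L := (Lambda q).
Implicit Types (x y : L).
Hypothesis gamma_der : derivation gamma.

Let gamma_lin : linear gamma := gamma_der.1.

Lemma derivation1 : gamma 1 = 0.
Proof.
have := gamma_der.2 1 1; rewrite !mulr1 mul1r => e.
by apply: (addrI (gamma 1)); rewrite -e addr0.
Qed.

(** Both sides are linear in z. On z = x' eps_r y' the rule for gamma on the products x x' and y' y
    regroups one expansion into the other. *)
Lemma leibniz_act (phi : forall n, K q n -> K q n) n x (z : K q n) y :
  linear (phi n) -> leibniz gamma phi ->
  phi n (act x z y) = act (gamma x) z y + act x (phi n z) y + act x z (gamma y).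
Proof.
move=> lphi Hphi.
have l1 : linear (fun z : K q n => phi n (act x z y)).
  by move=> c u v; rewrite act_linear lphi.
have l2 : linear (fun z : K q n =>
    act (gamma x) z y + act x (phi n z) y + act x z (gamma y)).
  move=> c u v; rewrite lphi !act_linear !scalerDr.
  by rewrite [RHS]addrACA [in RHS](addrACA (c *: act (gamma x) u y)).
apply: (K_ext l1 l2) => r x' y' lr; rewrite act_act !Hphi // !gamma_der.2.
rewrite !actDm !act_act actDl actDr.
by rewrite !addrA; congr (_ + _); rewrite -!addrA.
Qed.

Section Existence.
Variable psi : forall n, nat -> K q n.
Hypothesis gamma_ve : forall v, gamma (Le q v) = 0.
Hypothesis psi_corner : forall n r, (r <= n.+1)%N ->
  act (Le q (origv n r)) (psi n r) (Le q (termv n r)) = psi n r.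

(** The value that the Leibniz rule forces at x eps_r y; being bilinear in x and y, it extends to
    tensors. *)
Definition leibniz_value n r x y : K q n :=
  act (gamma x) (eps q n r) y + act x (psi n r) y + act x (eps q n r) (gamma y).

Lemma leibniz_value_bilin n r : bilin (leibniz_value n r).
Proof.
split=> [y|x] c u v; rewrite /leibniz_value gamma_lin.
  rewrite !actDl !actZl !scalerDr.
  by rewrite [RHS]addrACA [in RHS](addrACA (c *: act (gamma u) _ y)).
rewrite !actDr !actZr !scalerDr.
by rewrite [RHS]addrACA [in RHS](addrACA (c *: act (gamma x) _ u)).
Qed.

Definition leibniz_map n (z : K q n) : K q n :=
  \sum_(r < n.+2) tens_lift (leibniz_value n r) (kval z r).

(** The element x eps_r y is stored with its idempotents absorbed into x and y. They drop out of the
    value because gamma kills them and [psi n r] lies in the corner. *)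
Lemma leibniz_map_act n r x y : (r <= n.+1)%N ->
  leibniz_map (act x (eps q n r) y) = leibniz_value n r x y.
Proof.
move=> lr; pose i0 : 'I_n.+2 := Ordinal (lr : (r < n.+2)%N).
rewrite /leibniz_map (bigD1 i0) //= big1 ?addr0; last first.
  move=> i ne_i; rewrite !ffunE.
  rewrite (negPf ne_i : (i == r :> nat) = false) bimul0.
  exact: linear_zero (tens_lift_linear (leibniz_value_bilin _ _)).
rewrite !ffunE eqxx bimulE (tens_liftE (leibniz_value_bilin _ _)).
rewrite /leibniz_value !gamma_der.2 !gamma_ve mulr0 mul0r addr0 add0r.
by rewrite !act_eps -act_act psi_corner.
Qed.

Lemma leibniz_extension_ex : exists phi, leibniz_extension gamma psi phi.
Proof.
have eps_val n r : (r <= n.+1)%N -> leibniz_map (eps q n r) = psi n r.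
  move=> lr; rewrite -[eps q n r]act11 leibniz_map_act // /leibniz_value.
  by rewrite derivation1 act0l act0r add0r addr0 act11.
exists leibniz_map; split=> // [n c u v|n r x y lr].
  rewrite /leibniz_map scaler_sumr -big_split /=; apply: eq_bigr => r _.
  by rewrite kval_linear (tens_lift_linear (leibniz_value_bilin _ _)).
by rewrite leibniz_map_act // eps_val.
Qed.

End Existence.

(** At x eps_r y the terms with gamma(x) and gamma(y) agree on both sides because d is a bimodule
    map, which leaves [chain]. Degree 0 lifts gamma since psi vanishes there and gamma kills the
    idempotents of eps_r. *)
Lemma derivation_operator_gens (psi : forall n, nat -> K q n) phi :
  (forall v, gamma (Le q v) = 0) -> (forall r, psi 0%N r = 0) ->
  (forall m r, (r <= m.+2)%N -> phi m (diffK_gen q m r) = diffK (psi m.+1 r)) ->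
  leibniz_extension gamma psi phi -> derivation_operator gamma phi.
Proof.
move=> gamma_ve psi0 chain [lphi phi_eps Hphi]; split=> // [m z|z].
  have l1 : linear (fun z : K q m.+1 => phi m (diffK z)).
    by move=> c u v; rewrite diffK_linear lphi.
  have l2 : linear (fun z : K q m.+1 => diffK (phi m.+1 z)).
    by move=> c u v; rewrite lphi diffK_linear.
  apply: (K_ext l1 l2) => r x y lr.
  rewrite diffK_eps // leibniz_act // Hphi // phi_eps // chain //.
  by rewrite !(lin_add (@diffK_linear _ _ _)) !diffK_act diffK_gens.
have l1 : linear (fun z : K q 0 => augm (phi 0%N z)).
  by move=> c u v; rewrite lphi augm_linear.
have l2 : linear (fun z : K q 0 => gamma (augm z)).
  by move=> c u v; rewrite augm_linear gamma_lin.
apply: (K_ext l1 l2) => r x y lr.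
rewrite Hphi // phi_eps // psi0 act0m addr0 (lin_add (@augm_linear _ _)).
by rewrite !augm_eps // !gamma_der.2 !gamma_ve !(mulr0, mul0r, addr0, add0r).
Qed.

End LeibnizExtensions.

(** * Derivations of Lambda with prescribed values on the arrows *)

Section ArrowDerivations.
Variables (k : fieldType) (q : k).
Notation L := (Lambda q).
Implicit Types (s t : seq arrow).

Lemma LeM v w : Le q v * Le q w = if v == w then Le q v else 0.
Proof.
rewrite -rmorphM [ve k v * _]pmulU qcat_trivr -[pterm _]/v eq_sym.
by case: eqP => _ //=; rewrite linear0.
Qed.

Lemma LpiM (x y : pathalg k) : Lpi q (x * y) = Lpi q x * Lpi q y.
Proof. exact: rmorphM. Qed.

Variable d : arrow -> L.
Hypothesis d_src : forall x, Le q (src x) * d x = d x.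
Hypothesis d_tgt : forall x, d x * Le q (tgt x) = d x.

(** The empty word gives 1; the origin idempotent is supplied separately, in [Lpi_pgen] and
    [path_der], so the recursion does not track vertices. *)
Definition word s : L := foldr (fun x w => Lpi q (ar k x) * w) 1 s.

(** The Leibniz expansion of a word: the sum over its letters x of the word with that letter
    replaced by d x. *)
Fixpoint dword s : L :=
  if s is x :: s' then d x * word s' + Lpi q (ar k x) * dword s' else 0.

Lemma word_cat s t : word (s ++ t) = word s * word t.
Proof. by elim: s => [|x s IHs] /=; rewrite ?mul1r // IHs mulrA. Qed.

Lemma dword_cat s t : dword (s ++ t) = dword s * word t + word s * dword t.
Proof.
elim: s => [|x s IHs] /=; first by rewrite mul0r add0r mul1r.
by rewrite IHs word_cat mulrDr mulrDl !mulrA addrA.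
Qed.

Lemma word_term v s : is_path v s ->
  Le q v * word s * Le q (endpoint v s) = Le q v * word s.
Proof.
elim: s v => [|x s IHs] v /=; first by rewrite mulr1 Le_idem.
case/andP => _ /IHs e; have -> : Lpi q (ar k x) = Lpi q (ar k x) * Le q (tgt x).
  by rewrite arMLe eqxx.
by rewrite -!mulrA [X in _ * (_ * X)]mulrA e.
Qed.

Lemma dword_term v s : is_path v s ->
  Le q v * dword s * Le q (endpoint v s) = Le q v * dword s.
Proof.
elim: s v => [|x s IHs] v /=; first by rewrite mulr0 mul0r.
case/andP => _ ps; rewrite mulrDr mulrDl; congr (_ + _).
  by rewrite -(d_tgt x) -!mulrA [X in _ * (_ * X)]mulrA word_term.
have -> : Lpi q (ar k x) = Lpi q (ar k x) * Le q (tgt x) by rewrite arMLe eqxx.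
by rewrite -!mulrA [X in _ * (_ * X)]mulrA IHs.
Qed.

Definition path_der (p : qpath) : L := Le q (porig p) * dword (val p).2.

Lemma Lpi_pgen p : Lpi q (pgen k p) = Le q (porig p) * word (val p).2.
Proof.
case: p => [[v s] ps]; rewrite /porig /=.
elim: s v ps => [|x s IHs] v ps.
  by rewrite mulr1; congr (Lpi q (pgen k _)); apply: val_inj.
have /andP[/eqP sx ps'] := ps.
have [w ew vw] := @qcatE (qarrow x) (@QPath (tgt x, s) ps') erefl.
have -> : pgen k (@QPath (v, x :: s) ps) = ar k x * pgen k (@QPath (tgt x, s) ps').
  rewrite [RHS]pmulU ew; congr (pgen k _); apply: val_inj.
  by rewrite vw /= /porig /= sx.
rewrite LpiM (IHs _ ps') /= mulrA arMLe eqxx mulrA; congr (_ * _).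
by rewrite LeMar [src x]sx eqxx.
Qed.

(** For composable paths this is the Leibniz rule for concatenated words. Otherwise each term
    contains a product of two distinct vertex idempotents and vanishes. *)
Lemma path_der_cat p r :
  path_der p * Lpi q (pgen k r) + Lpi q (pgen k p) * path_der r =
  if qcat p r is Some w then path_der w else 0.
Proof.
have ep : path_der p * Le q (pterm p) = path_der p := dword_term (qpathP p).
have wp : Lpi q (pgen k p) * Le q (pterm p) = Lpi q (pgen k p).
  by rewrite Lpi_pgen; apply: word_term (qpathP p).
have [pr|pr] := eqVneq (pterm p) (porig r); last first.
  rewrite (qcatN pr) -ep -wp Lpi_pgen /path_der -!mulrA [Le _ _ * (Le _ (porig r) * _)]mulrA.
  by rewrite [Le _ (pterm _) * (Le _ (porig r) * _)]mulrA LeM (negPf pr) !(mul0r, mulr0) addr0.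
have [w -> vw] := qcatE pr; have ow : porig w = porig p by rewrite {1}/porig vw.
rewrite [Lpi q (pgen k r)]Lpi_pgen {2 3}/path_der ow vw dword_cat -pr !mulrA ep wp.
by rewrite Lpi_pgen /path_der mulrDr !mulrA.
Qed.

Definition pathalg_der : pathalg k -> L := lin_ext path_der.

Lemma pathalg_der_linear : linear pathalg_der.
Proof. exact: lin_ext_linear. Qed.

Lemma pathalg_der_pgen p : pathalg_der (pgen k p) = path_der p.
Proof. by rewrite [pgen _]unlock; apply: lin_extU. Qed.

Lemma pathalg_derM (x y : pathalg k) :
  pathalg_der (x * y) = pathalg_der x * Lpi q y + Lpi q x * pathalg_der y.
Proof.
have lD := pathalg_der_linear; have DD := lin_add lD; have DZ := lin_scale lD.
have D0 := linear_zero lD.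
elim/path_ind: x => [|x x' Hx Hx'|c p Hp|p].
- by rewrite mul0r D0 linear0 !mul0r addr0.
- by rewrite mulrDl !DD Hx Hx' linearD !mulrDl addrACA.
- by rewrite -scalerAl !DZ Hp [Lpi q (c *: _)]linearZ /= -!scalerAl scalerDr.
elim/path_ind: y => [|y y' Hy Hy'|c r Hr|r].
- by rewrite mulr0 D0 linear0 !mulr0 addr0.
- by rewrite mulrDr !DD Hy Hy' linearD !mulrDr addrACA.
- by rewrite -scalerAr !DZ Hr [Lpi q (c *: _)]linearZ /= -!scalerAr scalerDr.
rewrite !pathalg_der_pgen path_der_cat [pgen k p * _]pmulU.
by case: qcat => [w|] /=; rewrite ?D0 ?pathalg_der_pgen.
Qed.

Lemma pathalg_der_ve v : pathalg_der (ve k v) = 0.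
Proof. by rewrite pathalg_der_pgen /path_der mulr0. Qed.

Lemma pathalg_der_ar x : pathalg_der (ar k x) = d x.
Proof. by rewrite pathalg_der_pgen /path_der /= mulr1 mulr0 addr0 d_src. Qed.

Hypothesis d_rel : forall u, u \in relators q -> pathalg_der u = 0.

(** On x s y the outer Leibniz terms contain the image of the relator s, which is 0 in Lambda, and
    the middle term contains the derivative of s. *)
Lemma pathalg_der_ideal u : u \in lspan (ideal_gen q) -> pathalg_der u = 0.
Proof.
have lD := pathalg_der_linear.
move=> /asboolP[t Ht ->]; rewrite (lin_sum lD) big_seq big1 // => z /Ht.
case=> [x [s [y [sR ->]]]]; rewrite (lin_scale lD) !pathalg_derM LpiM.
by rewrite (relation sR) (d_rel sR) !(mulr0, mul0r, addr0) scaler0.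
Qed.

Lemma arrow_derivation : exists gamma : L -> L,
  [/\ derivation gamma, forall v, gamma (Le q v) = 0 &
      forall x, gamma (Lpi q (ar k x)) = d x].
Proof.
have lD := pathalg_der_linear.
pose gamma (x : L) := pathalg_der (lrepr x).
(* Independence of the chosen representative is the vanishing on the ideal. *)
have gE u : gamma (Lpi q u) = pathalg_der u.
  apply/eqP; rewrite -subr_eq0 -(lin_opp lD) -(lin_add lD); apply/eqP.
  by apply/pathalg_der_ideal/lpi_inj; rewrite lreprK.
exists gamma; split=> [|v|x]; last by rewrite gE pathalg_der_ar.
  split=> [c|]; elim/Lpi_ind=> x; elim/Lpi_ind=> y.
    by rewrite -linearP !gE lD.
  by rewrite -LpiM !gE pathalg_derM.
by rewrite gE pathalg_der_ve.
Qed.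

End ArrowDerivations.

(** * Relations in Lambda and derivations supported on the loop a *)

Section LoopDerivations.
Variables (k : fieldType) (q : k).
Notation L := (Lambda q).

Lemma LaLa : La q * La q = 0.
Proof. by rewrite -LpiM; apply: relation; rewrite !inE; apply/or4P/Or41/eqxx. Qed.
Lemma LbLb : Lb q * Lb q = 0.
Proof. by rewrite -LpiM; apply: relation; rewrite !inE; apply/or4P/Or42/eqxx. Qed.
Lemma LaLc : La q * Lc q = 0.
Proof. by rewrite -LpiM; apply: relation; rewrite !inE; apply/or4P/Or44/eqxx. Qed.
Lemma LaLb : La q * Lb q = q *: (Lb q * La q).
Proof.
apply/eqP; rewrite -subr_eq0 -!LpiM -linearZ -linearB /=; apply/eqP.
by apply: relation; rewrite !inE; apply/or4P/Or43/eqxx.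
Qed.

(** With b and c sent to 0, the last three equations say that the derivation kills a^2, ab - qba and
    ac; b^2 is killed automatically. The first two place z in the corner of a. *)
Lemma cochain_derivation_ex (z : L) :
  Le q V1 * z = z -> z * Le q V1 = z ->
  z * La q + La q * z = 0 -> z * Lb q = q *: (Lb q * z) -> z * Lc q = 0 ->
  exists gamma : L -> L, cochain_derivation z 0 0 gamma.
Proof.
move=> ez ze za zb zc; pose d x : L := if x is Aa then z else 0.
have d_src x : Le q (src x) * d x = d x by case: x; rewrite /= ?ez ?mulr0.
have d_tgt x : d x * Le q (tgt x) = d x by case: x; rewrite /= ?ze ?mul0r.
have [|gamma [der gamma_ve gamma_ar]] := @arrow_derivation _ q d d_src d_tgt; last first.
  by exists gamma; split=> //; split; apply: gamma_ar.
have lD := pathalg_der_linear d.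
have dM x y : pathalg_der d (ar k x * ar k y)
    = d x * Lpi q (ar k y) + Lpi q (ar k x) * d y.
  by rewrite pathalg_derM // !pathalg_der_ar.
move=> u; rewrite !inE => /or4P[]/eqP->.
- by rewrite dM.
- by rewrite dM mul0r mulr0 addr0.
- rewrite (lin_add lD) (lin_opp lD) (lin_scale lD) !dM !(mul0r, mulr0).
  by rewrite addr0 add0r [X in X - _]zb subrr.
- by rewrite dM mulr0 addr0.
Qed.

Lemma cochain_derivation_ve (l0 l1 l2 : L) gamma v :
  cochain_derivation l0 l1 l2 gamma -> gamma (Le q v) = 0.
Proof. by case=> _ e1 e2 _; case: v. Qed.

Lemma eps_corner n r : act (Le q (origv n r)) (eps q n r) (Le q (termv n r)) = eps q n r.
Proof. by have := act_eps n r (1 : L) 1; rewrite mul1r mulr1 act11. Qed.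

End LoopDerivations.

(** * The operator of eta and the grading by the letter a *)

Section Eta.
Variables (k : fieldType) (q : k).
Notation L := (Lambda q).

Lemma eta_derivation_ex :
  exists eta : L -> L, cochain_derivation (La q) 0 0 eta.
Proof.
apply: cochain_derivation_ex; rewrite ?LaLa ?addr0 ?LaLc ?LaLb //.
  by rewrite LeMar.
by rewrite arMLe.
Qed.

(* The degree in a of f^n_r; at n = 0, r = 1 truncation gives 0 - 1 = 0. *)
Definition a_weight (n r : nat) : nat := if (r <= n)%N then (n - r)%N else (n - 1)%N.

Lemma psi_etaE n r : (r <= n.+1)%N -> psi_eta q n r = eps q n r *+ a_weight n r.
Proof.
rewrite /psi_eta /a_weight; case: eqP => [->|_ _]; last by case: ifP.
by case: r => [|[|]].
Qed.

Lemma psi_eta_corner n r : (r <= n.+1)%N ->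
  act (Le q (origv n r)) (psi_eta q n r) (Le q (termv n r)) = psi_eta q n r.
Proof. by move=> lr; rewrite psi_etaE // actMn eps_corner. Qed.

Variables (eta : L -> L) (phi : forall n, K q n -> K q n).
Hypothesis eta_coch : cochain_derivation (La q) 0 0 eta.
Hypothesis phi_ext : leibniz_extension eta (psi_eta q) phi.

(** [homog w z] says that z has weight w. Multiplying a generator by a raises the weight by one
    since eta(a) = a, while b and c preserve it; this matches every term of the differential. *)
Lemma eta_operator : derivation_operator eta phi.
Proof.
have [der _ _ [etaa etab etac]] := eta_coch.
have [lphi phi_eps Hphi] := phi_ext.
apply: (derivation_operator_gens der) phi_ext => [v|r|m r lr].
- exact: cochain_derivation_ve eta_coch.
- by [].
have eta1 := derivation1 der.
have phiE s x y : (s <= m.+1)%N -> phi (act x (eps q m s) y) =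
    act (eta x) (eps q m s) y + act x (eps q m s) y *+ a_weight m s
    + act x (eps q m s) (eta y).
  by move=> ls; rewrite Hphi // phi_eps // psi_etaE // actMn.
pose homog w (z : K q m) := phi z = z *+ w.
have homogD w z z' : homog w z -> homog w z' -> homog w (z + z').
  by rewrite /homog => e e'; rewrite (lin_add (lphi m)) e e' mulrnDl.
(* The alternative c = 0 covers the terms switched off by [kdelta], whose weight need not fit. *)
have homogZ w c z : c = 0 \/ homog w z -> homog w (c *: z).
  rewrite /homog (lin_scale (lphi m)) => -[->|->]; last by rewrite scalerMnr.
  by rewrite !scale0r mul0rn.
have homogN w z : homog w z -> homog w (- z).
  by rewrite /homog => e; rewrite (lin_opp (lphi m)) e mulNrn.
have la s : (s <= m.+1)%N -> homog (a_weight m s).+1 (lact (La q) (eps q m s)).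
  by move=> ls; rewrite /homog /lact phiE // etaa eta1 act0r addr0 -mulrS.
have ra s : (s <= m.+1)%N -> homog (a_weight m s).+1 (ract (eps q m s) (La q)).
  by move=> ls; rewrite /homog /ract phiE // etaa eta1 act0l add0r -mulrSr.
have lx x s : eta x = 0 -> (s <= m.+1)%N -> homog (a_weight m s) (lact x (eps q m s)).
  by move=> ex ls; rewrite /homog /lact phiE // ex eta1 act0l act0r addr0 add0r.
have rx x s : eta x = 0 -> (s <= m.+1)%N -> homog (a_weight m s) (ract (eps q m s) x).
  by move=> ex ls; rewrite /homog /ract phiE // ex eta1 act0l act0r addr0 add0r.
(* Here psi multiplies the generator by its weight, so the goal becomes that d eps_r is homogeneous
   of that weight. *)
rewrite psi_etaE // -scaler_nat (lin_scale (@diffK_linear _ _ _)) scaler_nat.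
rewrite diffK_gens //; rewrite -/(homog _ _) /diffK_gen.
case: (leqP r m.+1) => lr1.
  have ew : a_weight m.+1 r = (m.+1 - r)%N by rewrite /a_weight lr1.
  rewrite ew; apply: (homogD); apply: (homogZ); rewrite /kdelta.
    have [<-|ne] := eqVneq m.+1 r; [by left; rewrite subrr|right].
    have lrm : (r <= m)%N by rewrite -ltnS ltn_neqAle eq_sym ne.
    have -> : (m.+1 - r)%N = (a_weight m r).+1 by rewrite /a_weight lrm subSn.
    by apply: (homogD); [|apply: (homogZ); right]; [apply: (la)|apply: (ra)].
  case: r {lr ew} lr1 => [|r] lr1 /=; [by left; rewrite subrr|right].
  have -> : (m.+1 - r.+1)%N = a_weight m r by rewrite /a_weight -ltnS lr1.
  by apply: (homogD); apply: (homogZ); right; [apply: (lx)|apply: (rx)]; rewrite // ltnW.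
have -> : a_weight m.+1 r = m by rewrite /a_weight leqNgt lr1 /= subn1.
case: eqP => [[em]|nm].
  (* Here m = 0, and both generators of degree 0 have weight 0, the second by truncated
     subtraction. *)
  have w0 s : (s <= 1)%N -> a_weight m s = m by rewrite em; case: s => [|[|]].
  apply: (homogD); [|apply: (homogN)].
    by rewrite -{1}(w0 1%N) //; apply: (lx).
  by rewrite -{1}(w0 0%N) //; apply: (rx).
apply: (homogD); [|apply: (homogZ); right].
  (* The weight of eps_(m+1) is m - 1, so m > 0 is needed to avoid truncation. *)
  have ew : m = (a_weight m m.+1).+1.
    rewrite /a_weight ltnn subn1 prednK // lt0n.
    by apply/eqP => m0; apply: nm; rewrite m0.
  by rewrite [X in homog X _]ew; apply: (la).
have ew : m = a_weight m 0 by rewrite /a_weight subn0.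
by rewrite [X in homog X _]ew; apply: (rx).
Qed.

End Eta.

(** * The operator of chi, at q = 1 *)

Section Chi.
Variable k : fieldType.
Notation L := (Lambda (1 : k)).
Notation a := (La (1 : k)).
Notation b := (Lb (1 : k)).
Notation c := (Lc (1 : k)).

Lemma LaLb1 : a * b = b * a.
Proof. by rewrite LaLb scale1r. Qed.

Lemma chi_derivation_ex : exists chi : L -> L, cochain_derivation (a * b) 0 0 chi.
Proof.
apply: cochain_derivation_ex.
- by rewrite mulrA LeMar.
- by rewrite -mulrA arMLe.
- by rewrite LaLb1 -mulrA LaLa mulr0 add0r -LaLb1 mulrA LaLa mul0r.
- by rewrite -mulrA LbLb mulr0 LaLb1 mulrA LbLb mul0r scaler0.
- by rewrite LaLb1 -mulrA LaLc mulr0.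
Qed.

Lemma loop_eps_corner m s x : tgt x = V1 -> (s <= m)%N ->
  act (Le 1 V1) (act (Lpi (1 : k) (ar k x)) (eps 1 m s) 1) (Le 1 V1) =
    act (Lpi (1 : k) (ar k x)) (eps 1 m s) 1 /\
  act (Le 1 V1) (act 1 (eps 1 m s) (Lpi (1 : k) (ar k x))) (Le 1 V1) =
    act 1 (eps 1 m s) (Lpi (1 : k) (ar k x)).
Proof.
move=> tx ls.
have os : origv m s = V1 by rewrite /origv; case: (m) (s) ls => [|?] [|[]].
have ts : termv m s = V1 by rewrite /termv ltn_eqF.
split; apply: act_eps_corner; rewrite ?os ?ts.
- by rewrite arMLe tx LeMar.
- by rewrite mulr1 Le_idem.
- by rewrite mul1r Le_idem.
- by rewrite LeMar arMLe tx.
Qed.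

Lemma psi_chi_corner n r : (r <= n.+1)%N ->
  act (Le 1 (origv n r)) (psi_chi (1 : k) n r) (Le 1 (termv n r)) = psi_chi (1 : k) n r.
Proof.
move=> lr; rewrite /psi_chi; case: n lr => [|n] lr /=; first exact: act0m.
have -> : origv n.+1 r = V1 by [].
case: ltnP => rn; last case: eqP => [_|/eqP nr]; last 2 first.
- exact: act0m.
- have -> : r = n.+2 by lia.
  rewrite /termv eqxx actMn actDm; congr ((_ + _) *+ _); apply: act_eps_corner.
  + by rewrite /origv /= arMLe LeMar.
  + by rewrite /termv eqxx mulr1 Le_idem.
  + by rewrite mul1r Le_idem.
  + by rewrite /termv /= LeMar arMLe.
have -> : termv n.+1 r = V1 by rewrite /termv ltn_eqF // ltnS ltnW.
have [e1 _] := @loop_eps_corner n.+1 r.+1 Aa erefl rn.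
have [_ e2] := @loop_eps_corner n.+1 r Ab erefl (ltnW rn).
by rewrite actDm actMn actZm actZm /lact /ract [in LHS]e1 [in LHS]e2.
Qed.

(** The scalars [(r < m)%:R] and m - r both vanish at r = m, so one formula absorbs the cases,
    degree 0 included. *)
Lemma psi_chiE m r : (r <= m)%N -> psi_chi (1 : k) m r =
  ((~~ odd r)%:R * (r < m)%:R * (-1) ^+ m.+1) *: act a (eps 1 m r.+1) 1
  + (m - r)%:R *: act 1 (eps 1 m r) b.
Proof.
rewrite /psi_chi leq_eqVlt => /predU1P[->|rm].
  by rewrite ltnn eqxx subnn mulr0 mul0r !scale0r addr0; case: eqP.
by rewrite gtn_eqF ?rm ?mulr1 -?scalerA ?scaler_nat //; apply: leq_ltn_trans rm.
Qed.

Lemma diffK_gen1 m r : (r <= m.+1)%N -> diffK_gen (1 : k) m r =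
  (r <= m)%:R *: (act a (eps 1 m r) 1 + (-1) ^+ (m.+1 - r) *: act 1 (eps 1 m r) a)
  + (0 < r)%:R *: ((-1) ^+ (m.+1 - r) *: act b (eps 1 m r.-1) 1
                   + (-1) ^+ m.+1 *: act 1 (eps 1 m r.-1) b).
Proof.
move=> lr.
have e1 : 1 - kdelta k m.+1 r = (r <= m)%:R.
  rewrite /kdelta; move: lr; rewrite leq_eqVlt => /predU1P[->|lr].
    by rewrite eqxx ltnn subrr.
  by rewrite gtn_eqF // subr0 -ltnS lr.
have e2 : 1 - kdelta k r 0 = (0 < r)%:R.
  by rewrite /kdelta; case: (r) => [|r'] /=; rewrite ?subrr ?subr0.
by rewrite /diffK_gen lr e1 e2 expr1n mulr1 /lact /ract.
Qed.

(* The components of the chain condition at eps_r: the five vectors stand for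
   ab eps_r, a eps_r b, a eps_(r+1) a, eps_r ab and b eps_(r-1) b. *)
Lemma chi_identity (V : lmodType k) (t1 t2 t3 t4 t5 : V) (m r : nat) :
  (r <= m)%N ->
  let s : k := (~~ odd r)%:R in let d : k := (r < m)%:R in
  let e : k := (-1) ^+ (m.+1 - r) in let t : k := (-1) ^+ m.+1 in
  let p : k := (0 < r)%:R in let s' : k := (odd r)%:R in
  t1 + (m - r)%:R *: t2 + e *: ((s * d * t) *: t3 + (m.+1 - r)%:R *: t4)
  + p *: (e *: ((s' * t) *: t1 + (m.+1 - r)%:R *: t5) + t *: ((s' * t) *: t2))
  = (s * - t) *: (d *: ((- e) *: t3) + ((- e) *: t1 + t *: t2))
    + (m.+1 - r)%:R *: (t2 + e *: t4 + p *: (e *: t5)).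
Proof.
move=> lr s d e t p s'.
have tt : t * t = 1 by rewrite /t -expr2 sqrr_sign.
(* This is (-1)^(m+1) = (-1)^r (-1)^(m+1-r), with r replaced by its parity. *)
have te : t = (-1) ^+ odd r * e.
  by rewrite signr_odd /t /e -exprD subnKC // leqW.
have nu : (m.+1 - r)%:R = (m - r)%:R + 1 :> k by rewrite subSn // mulrSr.
rewrite nu; move: ((m - r)%:R) => n; rewrite {}/s {}/s' {}/p.
move: d e t tt te => d e t tt.
case: (boolP (odd r)) => [od|ev] /=; rewrite ?expr1 ?expr0 ?mulN1r ?mul1r => te.
  (* Odd r: t = -e, so the two t1 terms cancel, and t * t = 1 supplies the missing copy of t2. *)
  have -> : (0 < r)%N by case: (r) od.
  have ee : e * t = -1 by rewrite -[e]opprK -te mulNr tt.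
  rewrite !(mul0r, scale0r, add0r, mul1r, scale1r) !scalerDr !scalerA ee tt.
  rewrite scaleN1r scale1r !addrA [LHS](ACl (1*4*(2*6)*3*5)) /= subrr add0r.
  by rewrite scalerDl scale1r [e * _]mulrC.
(* Even r: t = e, and the -t2 on the right cancels the extra copy in m+1-r = (m-r) + 1. *)
rewrite !(mul0r, scale0r, add0r, mul1r, scale1r) te; move: te tt => -> tt.
rewrite !scalerDr !scalerA !(mulrN, mulNr, opprK) tt mulrA.
have -> : e * d * e = d by rewrite mulrAC tt mul1r.
rewrite !scalerDl !scaleNr !scale1r !addrA scaler0 addr0.
rewrite [RHS](ACl (2*4*1*(5*3)*6*7)) /= subrr addr0.
by rewrite [(n + 1) * e]mulrC [(n + 1) * _]mulrC.
Qed.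

Variables (chi : L -> L) (phi : forall n, K (1 : k) n -> K (1 : k) n).
Hypothesis chi_coch : cochain_derivation (a * b) 0 0 chi.
Hypothesis phi_ext : leibniz_extension chi (psi_chi 1) phi.

Lemma chi_operator : derivation_operator chi phi.
Proof.
have [der _ _ [chia chib chic]] := chi_coch.
have [lphi phi_eps Hphi] := phi_ext.
apply: (derivation_operator_gens der) phi_ext => [v|r|m r lr].
- exact: cochain_derivation_ve chi_coch.
- by [].
have chi1 := derivation1 der.
have phiE s x y : (s <= m.+1)%N -> phi (act x (eps 1 m s) y) =
    act (chi x) (eps 1 m s) y + act x (psi_chi 1 m s) y
    + act x (eps 1 m s) (chi y).
  by move=> ls; rewrite Hphi // phi_eps.
have phiD := lin_add (lphi m); have phiZ := lin_scale (lphi m).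
have dD := lin_add (@diffK_linear k 1 m); have dZ := lin_scale (@diffK_linear k 1 m).
have dmul x (z : K (1 : k) m) y x' y' : act x (act x' z y') y = act (x * x') z (y' * y).
  exact: act_act.
(* Three ranges: r <= m rests on [chi_identity], at r = m+1 both sides vanish, and r = m+2 is the
   generator ending in c. *)
have [rm|mr] := leqP r m.
  have rm1 : (r <= m.+1)%N := leqW rm.
  rewrite psi_chiE // dD !dZ !diffK_eps // !diffK_gen1 //.
  set t1 := act (a * b) (eps 1 m r) 1; set t2 := act a (eps 1 m r) b.
  set t3 := act a (eps 1 m r.+1) a; set t4 := act 1 (eps 1 m r) (a * b).
  set t5 := act b (eps 1 m r.-1) b.
  (* The term t1 comes from chi(a) = ab; the a eps_(r+1) part of psi dies by a^2 = 0. *)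
  have P1 : phi (act a (eps 1 m r) 1) = t1 + (m - r)%:R *: t2.
    rewrite phiE // chia chi1 act0r addr0 psi_chiE // actDm !actZm !dmul.
    by rewrite LaLa act0l scaler0 add0r !mulr1.
  (* Here chi(a) = ab adds one copy of t4, raising m - r to m+1-r. *)
  have P2 : phi (act 1 (eps 1 m r) a) =
      ((~~ odd r)%:R * (r < m)%:R * (-1) ^+ m.+1) *: t3 + (m.+1 - r)%:R *: t4.
    rewrite phiE // chia chi1 act0l add0r psi_chiE // actDm !actZm !dmul.
    by rewrite -LaLb1 !mul1r -addrA subSn // mulrSr scalerDl scale1r.
  (* The factor [(0 < r)%:R] is kept because [r.-1] is a dummy index at r = 0. Passing to r - 1
     flips the parity, and b^2 = 0 removes a term. *)
  have P34 : (0 < r)%:R *: ((-1) ^+ (m.+1 - r) *: phi (act b (eps 1 m r.-1) 1)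
        + (-1) ^+ m.+1 *: phi (act 1 (eps 1 m r.-1) b)) =
      (0 < r)%:R *: ((-1) ^+ (m.+1 - r) *: (((odd r)%:R * (-1) ^+ m.+1) *: t1
                         + (m.+1 - r)%:R *: t5)
        + (-1) ^+ m.+1 *: (((odd r)%:R * (-1) ^+ m.+1) *: t2)).
    rewrite /t1 /t2 /t3 /t4 /t5 {P1 P2 t1 t2 t3 t4 t5}.
    case: r rm {lr rm1} => [|r] rm; first by rewrite !scale0r.
    have lr : (r <= m)%N := ltnW rm.
    have lr1 : (r <= m.+1)%N := leqW lr.
    have -> : phi (act b (eps 1 m r) 1) = ((odd r.+1)%:R * (-1) ^+ m.+1) *:
        act (a * b) (eps 1 m r.+1) 1 + (m.+1 - r.+1)%:R *: act b (eps 1 m r) b.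
      rewrite phiE // chib chi1 act0l act0r add0r addr0 psi_chiE // rm.
      by rewrite actDm !actZm !dmul !mulr1 -LaLb1 subSS.
    have -> : phi (act 1 (eps 1 m r) b) = ((odd r.+1)%:R * (-1) ^+ m.+1) *:
        act a (eps 1 m r.+1) b.
      rewrite phiE // chib chi1 act0l act0r add0r addr0 psi_chiE // rm.
      by rewrite actDm !actZm !dmul LbLb act0r scaler0 addr0 !mulr1 !mul1r.
    by [].
  rewrite phiD !phiZ [phi (_ + _ *: act 1 _ a)]phiD [phi (_ + _ *: act 1 _ b)]phiD !phiZ.
  have E := chi_identity t1 t2 t3 t4 t5 rm; rewrite /= in E.
  rewrite P34 P1 P2 rm scale1r {}E ltnS rm subSS.
  rewrite !(actDm, actZm) !dmul LaLa LbLb !act0l !act0r.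
  rewrite !mul1r !mulr1 -/t1 -/t2 -/t3 -/t4 -/t5.
  rewrite add0r !scaler0 addr0 !scale1r.
  (* On the right, psi is taken in degree m+1 and d at eps_(r+1), so both signs are opposite to t
     and e. *)
  have -> : (-1) ^+ m.+2 = - (-1) ^+ m.+1 :> k by rewrite exprS mulN1r.
  suff -> : (-1) ^+ (m - r) = - (-1) ^+ (m.+1 - r) :> k by [].
  by rewrite (subSn rm) exprS mulN1r opprK.
have [er|mr1] := eqVneq r m.+1.
  (* Only b eps_m and eps_m b occur in d; phi kills both, since psi(eps_m) = 0 and chi(b) = 0. *)
  rewrite er psi_chiE // ltnn mulr0 mul0r scale0r subnn scale0r addr0.
  rewrite (linear_zero (@diffK_linear _ _ _)) diffK_gen1 // ltnn scale0r add0r.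
  rewrite phiZ phiD !phiZ !phiE ?leqnSn // chib chi1 psi_chiE // ltnn subnn.
  rewrite mulr0 mul0r subnn !scale0r !addr0 !act0m !act0l !act0r.
  by rewrite !(addr0, add0r, scaler0).
have {lr mr mr1} -> : r = m.+2 by lia.
have psi_last n : psi_chi (1 : k) n.+1 n.+2 =
    (act b (eps 1 n.+1 n.+2) 1 + act 1 (eps 1 n.+1 1) c) *+ n.
  by rewrite /psi_chi /= ltnNge leqnSn /= gtn_eqF // subn1.
rewrite psi_last -[in RHS]scaler_nat dZ dD !diffK_eps // [diffK_gen _ m 1]diffK_gen1 // /diffK_gen ltnn.
rewrite /lact /ract; case: m phiE phiD phiZ {dD dZ dmul} => [|m] phiE phiD phiZ.
  (* For m = 0 the multiplicity is 0, and phi kills c eps_1 - eps_0 c since chi(c) = 0 and psi is 0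
     in degree 0. *)
  rewrite eqxx scale0r phiD -scaleN1r phiZ !phiE // chic chi1 !act0l !act0r !act0m.
  by rewrite !(addr0, add0r, scaler0).
rewrite phiD phiZ !phiE // chia chic chi1 !act0l !act0r psi_last psi_chiE //.
rewrite actMn !actDm !actZm !act_act.
rewrite -LaLb1 ltn0Sn subn0 subn1 /= !scale1r !actDm !actZm !act_act LaLc act0r.
rewrite !mul1r !mulr1 scaler0 !addr0 add0r.
(* These are ab eps_(m+2), a eps_1 c, eps_0 bc and b eps_0 c. The two u4 terms on the right have
   opposite signs. On the left, m copies of u1 + u2 come from psi(eps_(m+2)); the last u1 comes from
   chi(a), the last u2 from psi(eps_0) c. *)
set u1 := act (a * b) _ _; set u2 := act a _ _; set u3 := act 1 _ _; set u4 := act b _ _.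
have -> : (-1) ^+ m.+1 = - (-1) ^+ m.+2 :> k by rewrite [in RHS]exprS mulN1r opprK.
rewrite scaleNr [in RHS](addrCA u2) -[in RHS]addrA [in RHS]addNKr.
rewrite !scalerDr [(-1) ^+ m.+2 *: (_ *: u2)]scalerA -expr2 sqrr_sign scale1r.
rewrite [(-1) ^+ m.+2 *: (_ *: u3)]scalerA [_ * m.+1%:R]mulrC -scalerA.
move: (m.+1%:R *: (_ *: u3)) => w.
rewrite !scaler_nat mulrnDl !mulrS !addrA.
by rewrite [LHS](ACl (1*2*4*3*5)).
Qed.

End Chi.

Unset Implicit Arguments.

(** The existence clauses, for the derivations and for the extensions, keep the universal statements
    from being vacuous. *)
Theorem proposition7p13 (k : fieldType) (q : k) :
  ((exists eta : Lambda q -> Lambda q, cochain_derivation (La q) 0 0 eta) /\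
   forall eta : Lambda q -> Lambda q, cochain_derivation (La q) 0 0 eta ->
     (exists phi, leibniz_extension eta (psi_eta q) phi) /\
     forall phi, leibniz_extension eta (psi_eta q) phi ->
       derivation_operator eta phi) /\
  ((exists chi : Lambda (1 : k) -> Lambda (1 : k),
      cochain_derivation (La 1 * Lb 1) 0 0 chi) /\
   forall chi : Lambda (1 : k) -> Lambda (1 : k),
     cochain_derivation (La 1 * Lb 1) 0 0 chi ->
     (exists phi, leibniz_extension chi (psi_chi 1) phi) /\
     forall phi, leibniz_extension chi (psi_chi 1) phi ->
       derivation_operator chi phi).
Proof.
split; split.
- exact: eta_derivation_ex.
- move=> eta Heta; split=> [|phi]; last exact: eta_operator.
  apply: leibniz_extension_ex => [|v|n r]; first by case: Heta.
    exact: cochain_derivation_ve Heta.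
  exact: psi_eta_corner.
- exact: chi_derivation_ex.
move=> chi Hchi; split=> [|phi]; last exact: chi_operator.
apply: leibniz_extension_ex => [|v|n r]; first by case: Hchi.
  exact: cochain_derivation_ve Hchi.
exact: psi_chi_corner.
Qed.
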